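(* Let $Y\subset\mathbb{P}^5$ be a cubic fourfold with $\dim\mathrm{Sing}(Y)=1$. Assume $C\subseteq\mathrm{Sing}(Y)$ is an irreducible curve whose linear span is $4$-dimensional. Then $C$ is a rational normal quartic in $\mathbb{P}^4$. In suitable linear coordinates $(x_0:\dots:x_5)$ on $\mathbb{P}^5$, the equation of $Y$ can be taken of the form $$\det\begin{pmatrix} x_0 & x_1 & x_2+2ax_5 \\ x_1 & x_2-ax_5 & x_3 \\ x_2+2ax_5 & x_3 & x_4 \end{pmatrix}+x_5^2\,l(x_0,\dots,x_4)+bx_5^3,$$ where $a,b\in\mathbb{C}$ and $l$ is a linear form in $x_0,\dots,x_4$.
   Context: We work over $\mathbb{C}$. A cubic fourfold is a hypersurface in $\mathbb{P}^5$ given by a nonzero cubic form. *)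

(* Defs.v *)
From mathcomp Require Import all_boot all_order all_algebra.
From mathcomp Require Import classical_sets reals.
From mathcomp Require Import complex mpoly.

Set Implicit Arguments.
Unset Strict Implicit.
Unset Printing Implicit Defensive.

Import GRing.Theory.
Local Open Scope ring_scope.
Local Open Scope classical_set_scope.

(* A point of P^n is represented by any of its homogeneous coordinate vectors,
   so a subset of P^n is a set of nonzero vectors of K^(n+1) that is stable
   under scaling by nonzero constants. *)
Section Projective.
Variables (K : closedFieldType) (n : nat).
Implicit Types (X Z : set 'rV[K]_n.+1) (F : {mpoly K[n.+1]}).

Definition proj_zeros (S : set {mpoly K[n.+1]}) : set 'rV[K]_n.+1 :=
  [set x : 'rV[K]_n.+1 | x != 0 /\ forall F, S F -> F.@[x 0] = 0].

Definition proj_closed X : Prop :=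
  exists S : set {mpoly K[n.+1]},
    (forall F, S F -> exists d : nat, F \is d.-homog) /\ X = proj_zeros S.

Definition irreducible_closed X : Prop :=
  [/\ proj_closed X, X !=set0 &
      forall A B, proj_closed A -> proj_closed B ->
        X `<=` A `|` B -> X `<=` A \/ X `<=` B].

Definition irreducible_chain X (d : nat) : Prop :=
  exists Z : nat -> set 'rV[K]_n.+1,
    (forall i, (i <= d)%N -> irreducible_closed (Z i) /\ Z i `<=` X) /\
    (forall i, (i < d)%N -> Z i `<` Z i.+1).

(* The Krull dimension of X is d. *)
Definition has_dim X (d : nat) : Prop :=
  irreducible_chain X d /\ ~ irreducible_chain X d.+1.

Definition irreducible_curve X : Prop := irreducible_closed X /\ has_dim X 1.

(* Sing of the hypersurface (as a scheme) F = 0, by the Jacobian criterion. *)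
Definition sing_locus F : set 'rV[K]_n.+1 :=
  [set x : 'rV[K]_n.+1 | [/\ x != 0, F.@[x 0] = 0 &
               forall i : 'I_n.+1, (F^`M(i)).@[x 0] = 0]].

(* The linear span of X is P(L), of projective dimension \dim L - 1. *)
Definition is_linear_span X (L : {vspace 'rV[K]_n.+1}) : Prop :=
  (forall x, X x -> x \in L) /\
  (forall M : {vspace 'rV[K]_n.+1},
     (forall x, X x -> x \in M) -> (L <= M)%VS).

(* X is the image of (s : t) |-> (s^d : s^(d-1) t : ... : t^d) with respect to
   some homogeneous coordinates on P(L), which is then a P^d. *)
Definition rational_normal_curve (d : nat) (L : {vspace 'rV[K]_n.+1}) X : Prop :=
  exists e : d.+1.-tuple 'rV[K]_n.+1, basis_of L e /\
    X = [set x : 'rV[K]_n.+1 | exists s t c : K, [/\ (s, t) != (0, 0), c != 0 &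
           x = c *: \sum_(i < d.+1) (s ^+ (d - i) * t ^+ i) *: e`_i]].

(* F written in the coordinates y for which x_i = sum_j g_ij y_j. *)
Definition change_coords (g : 'M[K]_n.+1) F : {mpoly K[n.+1]} :=
  F \mPo [tuple \sum_(j < n.+1) g i j *: 'X_j | i < n.+1].

End Projective.

Section NormalForm.
Variable K : closedFieldType.

Let x (k : nat) : {mpoly K[6]} := 'X_(inord k).

Definition normal_form_mx (a : K) : 'M[{mpoly K[6]}]_3 :=
  \matrix_(i < 3, j < 3)
    nth 0 (nth [::]
      [:: [:: x 0; x 1; x 2 + (2 * a) *: x 5];
          [:: x 1; x 2 - a *: x 5; x 3];
          [:: x 2 + (2 * a) *: x 5; x 3; x 4]] i) j.

Definition normal_form (a b : K) (l : {mpoly K[5]}) : {mpoly K[6]} :=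
  \det (normal_form_mx a) + x 5 ^+ 2 * mwiden l + b *: x 5 ^+ 3.

End NormalForm.

(* Main.v *)
Require Import Defs.
From mathcomp Require Import all_boot all_order all_algebra.
From mathcomp Require Import classical_sets reals.
From mathcomp Require Import complex mpoly.
From mathcomp Require Import boolp ring.

Set Implicit Arguments.
Unset Strict Implicit.
Unset Printing Implicit Defensive.

Import GRing.Theory Num.Theory.
Local Open Scope ring_scope.
Local Open Scope classical_set_scope.

(** Let [T] be the polarization of [F]; a point [x] is singular iff [T x x = 0].
    Choose points [p0, ..., p4] of [C] that form a basis of [L]. If [T] vanished on [L],
    then [F] would be a hyperplane times a quadric and its singular locus would contain
    a quadric surface, against [dim Sing = 1]. In the coordinates [x_i] of the [p_i] the
    cubic [F|L] has no square terms, so it is [x_0 x_1 x_2 x_3 x_4] times a quadratic form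
    [D] in the inverses [1 / x_i], and singular points with nonzero coordinates go to the
    kernel of [D]. As [C] spans [L], no relation [a / x_i + b / x_j = 0] holds on [C];
    this forces [ker D] to be a pencil [s u + t v], with pairwise independent
    [(u_i, v_i)]. Clearing denominators, [x_i] is proportional to the product of the
    [s u_j + t v_j] for [j != i], which is the parametrization of a rational normal
    quartic. In the corresponding basis [e0, ..., e4], comparing coefficients of [s] in
    [T (g s) (g s) w = 0], where [g s] is the point of parameter [s], determines [F|L] up
    to a scalar as the Hankel determinant and leaves six free coefficients in the part
    of [F] linear in [x_5]; adding to the sixth basis vector a combination of the [e_i]
    removes five of them, and the sixth is [a]. *)

(** * Polarization of cubic forms *)

(** Checked monomial by monomial: ['X_i] times the [i]-th derivative multiplies a monomial by its
    [i]-th exponent, and the exponents add up to the degree. *)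
Lemma mpoly_euler n (A : comNzRingType) d (F : {mpoly A[n]}) :
  F \is d.-homog -> \sum_i 'X_i * F^`M(i) = d%:R *: F.
Proof.
move=> /dhomogP hF.
have eX (m : 'X_{1..n}) :
    \sum_i 'X_i * ('X_[m])^`M(i) = (mdeg m)%:R *: 'X_[m] :> {mpoly A[n]}.
  rewrite mdegE natr_sum scaler_suml; apply: eq_bigr => i _.
  rewrite mderivX -scalerAr -mpolyXD; case: (posnP (m i)) => [->|mi].
    by rewrite !scale0r.
  by rewrite addmC submK // lep1mP -lt0n.
rewrite [in RHS](mpolyE F) scaler_sumr.
under eq_bigr => i _ do rewrite {1}(mpolyE F) raddf_sum mulr_sumr.
rewrite exchange_big big_seq [RHS]big_seq; apply: eq_bigr => m /hF <- /=.
rewrite scalerA mulrC -scalerA -eX scaler_sumr.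
by apply: eq_bigr => i _; rewrite mderivZ scalerAr.
Qed.

Lemma dhomog_mderiv n (A : nzRingType) d (F : {mpoly A[n]}) i :
  F \is d.+1.-homog -> F^`M(i) \is d.-homog.
Proof.
move=> /dhomogP hF; apply/dhomogP => m; rewrite mcoeff_msupp mcoeff_mderiv.
move=> hm; have : (m + U_(i))%MM \in msupp F.
  by rewrite mcoeff_msupp; apply: contraNneq hm => ->; rewrite mul0rn.
by move=> /hF /=; rewrite mdegD mdeg1 addn1 => -[].
Qed.

Lemma dhomog0_const n (A : nzRingType) (F : {mpoly A[n]}) :
  F \is 0.-homog -> F = (F@_0)%:MP.
Proof.
move=> /dhomogP hF; apply/mpolyP => m; rewrite mcoeffC.
case: eqVneq => [<-|m0]; first by rewrite mulr1.
rewrite mulr0; apply/eqP; apply: contraNT m0; rewrite -mcoeff_msupp.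
by move=> /hF /= /eqP; rewrite mdeg_eq0 eq_sym.
Qed.

Section Trilinear.
Variables (K : numFieldType) (n : nat).
Implicit Types x y z : 'rV[K]_n.

Definition trilin (t : 'I_n -> 'I_n -> 'I_n -> K) x y z :=
  \sum_i x 0 i * \sum_j y 0 j * \sum_k z 0 k * t i j k.

Definition sym_trilinear (T : 'rV[K]_n -> 'rV[K]_n -> 'rV[K]_n -> K) :=
  [/\ forall x y a z w, T x y (a *: z + w) = a * T x y z + T x y w,
      forall x y z, T x y z = T y x z & forall x y z, T x y z = T x z y].

Lemma trilin_sym t : (forall i j k, t i j k = t j i k) ->
  (forall i j k, t i j k = t i k j) -> sym_trilinear (trilin t).
Proof.
move=> t1 t2; split=> [x y a z w|x y z|x y z]; rewrite /trilin.
- rewrite mulr_sumr -big_split; apply: eq_bigr => i _ /=.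
  rewrite mulrCA -mulrDr; congr (_ * _).
  rewrite mulr_sumr -big_split; apply: eq_bigr => j _ /=.
  rewrite mulrCA -mulrDr; congr (_ * _).
  rewrite mulr_sumr -big_split; apply: eq_bigr => k _ /=.
  by rewrite !mxE mulrDl mulrA.
- under eq_bigr => i _ do rewrite mulr_sumr.
  rewrite exchange_big; apply: eq_bigr => j _ /=.
  rewrite mulr_sumr; apply: eq_bigr => i _.
  rewrite mulrCA; do 2!congr (_ * _).
  by apply: eq_bigr => k _; rewrite t1.
- apply: eq_bigr => i _; congr (_ * _).
  under eq_bigr => j _ do rewrite mulr_sumr.
  rewrite exchange_big; apply: eq_bigr => j _ /=.
  rewrite mulr_sumr; apply: eq_bigr => k _.
  by rewrite mulrCA t2.
Qed.

End Trilinear.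

Section CubicForm.
Variables (K : numClosedFieldType) (n : nat).
Implicit Types x y z : 'rV[K]_n.+1.

(** The last clause is an identity of polynomials: the coefficients of [F] in the new coordinates
    are the values of [T] on the columns of [g], which are the new basis vectors. *)
Definition polarizes (F : {mpoly K[n.+1]})
    (T : 'rV[K]_n.+1 -> 'rV[K]_n.+1 -> 'rV[K]_n.+1 -> K) :=
  [/\ sym_trilinear T,
      forall x, F.@[x 0] = T x x x,
      forall i x, (F^`M(i)).@[x 0] = 3 * T x x (delta_mx 0 i) &
      forall g : 'M[K]_n.+1, change_coords g F = \sum_a 'X_a * \sum_b 'X_b *
        \sum_c 'X_c * (T (row a g^T) (row b g^T) (row c g^T))%:MP].

Lemma lin_subst (g : 'M[K]_n.+1) (H : 'I_n.+1 -> {mpoly K[n.+1]}) :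
  \sum_i (\sum_a g i a *: 'X_a) * H i = \sum_a 'X_a * \sum_i g i a *: H i.
Proof.
under eq_bigr => i _ do rewrite mulr_suml.
rewrite exchange_big; apply: eq_bigr => a _ /=.
by rewrite mulr_sumr; apply: eq_bigr => i _; rewrite -scalerAl scalerAr.
Qed.

Lemma polarization (F : {mpoly K[n.+1]}) :
  F \is 3.-homog -> exists T, polarizes F T.
Proof.
(* Euler's identity is applied in degrees 3, 2 and 1, which accounts for the factor 6. *)
move=> hF; pose t i j k := (F^`M(i)^`M(j)^`M(k))@_0 / 6.
have h2 i : 2%:R *: F^`M(i) = \sum_j 'X_j * \sum_k 'X_k * (6 * t i j k)%:MP.
  have h1 := dhomog_mderiv i hF.
  rewrite -(mpoly_euler h1); apply: eq_bigr => j _; congr (_ * _).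
  have h0 := dhomog_mderiv j h1.
  rewrite -[LHS]scale1r -(mpoly_euler h0); apply: eq_bigr => k _; congr (_ * _).
  rewrite (dhomog0_const (dhomog_mderiv k h0)) /t; congr (_%:MP).
  by rewrite mulrCA divff ?mulr1 // pnatr_eq0.
have n2 : (2%:R : K) != 0 by rewrite pnatr_eq0.
have n3 : (3%:R : K) != 0 by rewrite pnatr_eq0.
have hi i : F^`M(i) = \sum_j 'X_j * \sum_k 'X_k * (3 * t i j k)%:MP.
  apply: (scalerI n2); rewrite h2 scaler_sumr; apply: eq_bigr => j _.
  rewrite scalerAr scaler_sumr; congr (_ * _); apply: eq_bigr => k _.
  rewrite scalerAr -mul_mpolyC -mpolyCM; congr (_ * _%:MP); ring.
have h3 : F = \sum_i 'X_i * \sum_j 'X_j * \sum_k 'X_k * (t i j k)%:MP.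
  apply: (scalerI n3); rewrite -(mpoly_euler hF) scaler_sumr.
  apply: eq_bigr => i _; rewrite scalerAr hi; congr (_ * _).
  rewrite scaler_sumr; apply: eq_bigr => j _.
  rewrite scalerAr scaler_sumr; congr (_ * _); apply: eq_bigr => k _.
  by rewrite scalerAr -mul_mpolyC -mpolyCM.
exists (trilin t); split.
- apply: trilin_sym => i j k; rewrite /t; last by rewrite mderiv_comm.
  by rewrite (mderiv_comm i j F).
- move=> x; rewrite {1}h3 /trilin raddf_sum; apply: eq_bigr => i _ /=.
  rewrite mevalM mevalXU; congr (_ * _); rewrite raddf_sum; apply: eq_bigr => j _ /=.
  rewrite mevalM mevalXU; congr (_ * _); rewrite raddf_sum; apply: eq_bigr => k _ /=.
  by rewrite mevalM mevalXU mevalC.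
- move=> i x; rewrite hi /trilin.
  rewrite raddf_sum mulr_sumr; apply: eq_bigr => j _ /=.
  rewrite mevalM mevalXU mulrCA; congr (_ * _).
  rewrite raddf_sum mulr_sumr; apply: eq_bigr => k _ /=.
  rewrite mevalM mevalXU mevalC mulrCA; congr (_ * (_ * _)).
  rewrite (bigD1 i) //= mxE !eqxx mul1r big1 ?addr0; last first.
    by move=> l /negPf li; rewrite mxE eqxx li mul0r.
  by rewrite /t (mderiv_comm k i) (mderiv_comm j i F).
- move=> g; pose y i : {mpoly K[n.+1]} := \sum_a g i a *: 'X_a.
  have yE i : 'X_i \mPo [tuple y i | i < n.+1] = y i.
    by rewrite comp_mpolyXU -tnth_nth tnth_mktuple.
  have -> : change_coords g F =
      \sum_i y i * \sum_j y j * \sum_k y k * (t i j k)%:MP.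
    rewrite /change_coords {1}h3 raddf_sum; apply: eq_bigr => i _ /=.
    rewrite rmorphM /= yE; congr (_ * _); rewrite raddf_sum; apply: eq_bigr => j _ /=.
    rewrite rmorphM /= yE; congr (_ * _); rewrite raddf_sum; apply: eq_bigr => k _ /=.
    by rewrite rmorphM /= yE comp_mpolyC.
  rewrite lin_subst; apply: eq_bigr => a _; congr (_ * _).
  transitivity (\sum_i \sum_b 'X_b * \sum_j g i a *: (g j b *:
      \sum_k y k * (t i j k)%:MP)).
    apply: eq_bigr => i _; rewrite lin_subst scaler_sumr; apply: eq_bigr => b _.
    by rewrite scalerAr scaler_sumr.
  rewrite exchange_big; apply: eq_bigr => b _ /=; rewrite -mulr_sumr; congr (_ * _).
  transitivity (\sum_i \sum_c 'X_c * \sum_j \sum_k g i a *: (g j b *: (g k c *: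
      (t i j k)%:MP)) : {mpoly K[n.+1]}).
    apply: eq_bigr => i _; under [RHS]eq_bigr => c _ do rewrite mulr_sumr.
    rewrite exchange_big; apply: eq_bigr => j _ /=.
    rewrite lin_subst !scaler_sumr; apply: eq_bigr => c _.
    by rewrite !scalerAr !scaler_sumr.
  rewrite exchange_big; apply: eq_bigr => c _ /=; rewrite -mulr_sumr; congr (_ * _).
  rewrite /trilin raddf_sum; apply: eq_bigr => i _ /=.
  rewrite mpolyCM !mxE raddf_sum mulr_sumr; apply: eq_bigr => j _ /=.
  rewrite mpolyCM !mxE raddf_sum !mulr_sumr; apply: eq_bigr => k _ /=.
  by rewrite !mxE -!mul_mpolyC -!mpolyCM.
Qed.

End CubicForm.

(** * Cubics singular along the rational normal quartic *)

Section HankelTensor.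
Variable K : numFieldType.

(* The symmetric tensors of the cubics [6 c det] (at [a = 0]) and [6 c normal_form]. *)
Definition hankel_tensor (c : K) (i j k : nat) : K :=
  match sort leq [:: i; j; k] with
  | [:: 0; 2; 4]%N => c
  | [:: 0; 3; 3]%N | [:: 1; 1; 4]%N => - 2 * c
  | [:: 1; 2; 3]%N => 2 * c
  | [:: 2; 2; 2]%N => - 6 * c
  | _ => 0
  end.

Definition normal_tensor (c a b : K) (l : nat -> K) (i j k : nat) : K :=
  match sort leq [:: i; j; k] with
  | [:: 0; 4; 5]%N => - (c * a)
  | [:: 1; 3; 5]%N => 4 * (c * a)
  | [:: 2; 2; 5]%N => - 6 * (c * a)
  | [:: 5; 5; 5]%N => 6 * c * (b + 4 * a ^+ 3)
  | [:: m; 5; 5]%N => 2 * c * l m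
  | [:: _; _; 5]%N => 0
  | _ => hankel_tensor c i j k
  end.

Lemma sort3C12 i j k : sort leq [:: i; j; k] = sort leq [:: j; i; k].
Proof.
apply/(perm_sortP leq_total leq_trans anti_leq).
by rewrite -(cat1s i) -(cat1s j) perm_catCA.
Qed.

Lemma sort3C23 i j k : sort leq [:: i; j; k] = sort leq [:: i; k; j].
Proof.
apply/(perm_sortP leq_total leq_trans anti_leq).
by rewrite perm_cons -(cat1s j) -(cat1s k) perm_catC.
Qed.

Variable t : nat -> nat -> nat -> K.
Hypothesis tC12 : forall i j k, t i j k = t j i k.
Hypothesis tC23 : forall i j k, t i j k = t i k j.

(** Symmetry leaves only sorted triples to compare: 35 entries instead of 125 for [n = 5]. *)
Lemma sym_tensor_sorted (n : nat) (f : nat -> nat -> nat -> K) :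
  (forall i j k, f i j k = f j i k) -> (forall i j k, f i j k = f i k j) ->
  (forall i j k, (i <= j <= k)%N -> (k < n)%N -> t i j k = f i j k) ->
  forall i j k, (i < n)%N -> (j < n)%N -> (k < n)%N -> t i j k = f i j k.
Proof.
move=> f12 f23 H i j k.
wlog ij : i j / (i <= j)%N => [W i_n j_n k_n|].
  case: (leqP i j) => [|/ltnW] ij; first exact: W.
  by rewrite tC12 f12; apply: W.
wlog jk : i j k ij / (j <= k)%N => [W i_n j_n k_n|_ _]; last exact/H/andP.
case: (leqP j k) => [|/ltnW] jk; first exact: W.
rewrite tC23 f23; case: (leqP i k) => [|/ltnW] ik; first exact: W.
by rewrite tC12 f12; apply: W.
Qed.

(* The coefficients of [s] in [t (g s) (g s) w] for the quartic curve
   [g s = (1, s, s^2, s^3, s^4)]. *)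
Definition quartic_relations (w : nat) :=
  [/\ t 0 0 w = 0, t 0 1 w = 0, 2 * t 0 2 w + t 1 1 w = 0,
      t 0 3 w + t 1 2 w = 0 & [/\ 2 * t 0 4 w + 2 * t 1 3 w + t 2 2 w = 0,
      t 1 4 w + t 2 3 w = 0, 2 * t 2 4 w + t 3 3 w = 0, t 3 4 w = 0 &
      t 4 4 w = 0]].

Hypothesis tR : forall w, quartic_relations w.

(** The relations hold for every third index, so by symmetry an entry can be rewritten through any
    two of its indices. Iterating kills all entries except those with index sum 6, which become
    multiples of [t 0 2 4]. *)
Lemma quartic_tensor_sorted i j k : (i <= j <= k)%N -> (k < 5)%N ->
  t i j k = hankel_tensor (t 0 2 4) i j k.
Proof.
have R0 w : t 0 0 w = 0 by case: (tR w).
have R1 w : t 0 1 w = 0 by case: (tR w).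
have R2 w : t 1 1 w = - 2 * t 0 2 w.
  by case: (tR w) => _ _ H _ _; apply/eqP; rewrite -subr_eq0 -H; apply/eqP; ring.
have R3 w : t 1 2 w = - t 0 3 w.
  by case: (tR w) => _ _ _ H _; apply/eqP; rewrite -subr_eq0 -H; apply/eqP; ring.
have R4 w : t 2 2 w = - 2 * t 0 4 w - 2 * t 1 3 w.
  by case: (tR w) => _ _ _ _ [H _ _ _ _]; apply/eqP; rewrite -subr_eq0 -H; apply/eqP; ring.
have R5 w : t 2 3 w = - t 1 4 w.
  by case: (tR w) => _ _ _ _ [_ H _ _ _]; apply/eqP; rewrite -subr_eq0 -H; apply/eqP; ring.
have R6 w : t 3 3 w = - 2 * t 2 4 w.
  by case: (tR w) => _ _ _ _ [_ _ H _ _]; apply/eqP; rewrite -subr_eq0 -H; apply/eqP; ring.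
have R7 w : t 3 4 w = 0 by case: (tR w) => _ _ _ _ [].
have R8 w : t 4 4 w = 0 by case: (tR w) => _ _ _ _ [].
have S i' j' k' : t i' j' k' = t k' i' j' by rewrite tC23 tC12.
have e13 : t 0 1 3 = 0 by rewrite R1.
have e112 : t 1 1 2 = 0 by rewrite tC23 R3 tC23 e13 oppr0.
have e022 : t 0 2 2 = 0.
  have /eqP := R2 2%N; rewrite e112 eq_sym mulf_eq0 oppr_eq0 pnatr_eq0 /=.
  by move/eqP.
have e023 : t 0 2 3 = 0 by rewrite -S R5 S R1 oppr0.
have e033 : t 0 3 3 = - 2 * t 0 2 4 by rewrite -S R6 S.
have e034 : t 0 3 4 = 0 by rewrite -S R7.
have e123 : t 1 2 3 = 2 * t 0 2 4 by rewrite R3 e033; ring.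
have e124 : t 1 2 4 = 0 by rewrite R3 e034 oppr0.
have e134 : t 1 3 4 = 0 by rewrite -S R7.
have e223 : t 2 2 3 = 0 by rewrite tC23 R5 tC23 e124 oppr0.
have e234 : t 2 3 4 = 0 by rewrite -S R7.
have e133 : t 1 3 3 = 0.
  have /eqP := R4 3%N; rewrite e223 tC23 e034 mulr0 add0r eq_sym oppr_eq0.
  by rewrite mulf_eq0 pnatr_eq0 => /eqP.
have E := (R0, R1, R7, R8, e112, e022, e023, e033, e034, e123, e124, e134, e223,
  e234, e133).
have e044 : t 0 4 4 = 0 by rewrite -S R8.
have e144 : t 1 4 4 = 0 by rewrite -S R8.
have e244 : t 2 4 4 = 0 by rewrite -S R8.
have e111 : t 1 1 1 = 0 by rewrite R2 tC23 R1 mulr0.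
have e113 : t 1 1 3 = 0 by rewrite R2 e023 mulr0.
have e114 := R2 4%N.
have e122 : t 1 2 2 = 0 by rewrite R3 tC23 e023 oppr0.
have e222 : t 2 2 2 = - 6 * t 0 2 4.
  by rewrite R4 (tC23 0 4 2) (tC23 1 3 2) e123; ring.
have e224 : t 2 2 4 = 0 by rewrite R4 e044 e134 !mulr0 subr0.
have e233 : t 2 3 3 = 0 by rewrite R5 tC23 e134 oppr0.
have e333 : t 3 3 3 = 0 by rewrite R6 tC23 e234 mulr0.
have e334 : t 3 3 4 = 0 by rewrite tC23 R7.
have e344 : t 3 4 4 = 0 by rewrite R7.
move=> /andP[]; case: i => [|[|[|[|[|i]]]]]; case: j => [|[|[|[|[|j]]]]] //;
  case: k => [|[|[|[|[|k]]]]] // _ _ _;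
  by rewrite /hankel_tensor /= ?(R0, R1) ?(e044, e144, e244, e111, e113, e114,
    e122, e222, e224, e233, e333, e334, e344) ?E.
Qed.

Lemma quartic_tensorE i j k : (i < 5)%N -> (j < 5)%N -> (k < 5)%N ->
  t i j k = hankel_tensor (t 0 2 4) i j k.
Proof.
apply: sym_tensor_sorted => // {}i {}j {}k; last exact: quartic_tensor_sorted.
  by rewrite /hankel_tensor sort3C12.
by rewrite /hankel_tensor sort3C23.
Qed.

(** Of the 15 entries with exactly one index 5, the nine relations at [w = 5] leave six independent
    ones, those fixed by the first six hypotheses. Entries without index 5 are known from the Hankel
    case. *)
Lemma normal_tensorE (a b : K) (l : nat -> K) : let c := t 0 2 4 in
  t 0 2 5 = 0 -> t 0 3 5 = 0 -> t 1 4 5 = 0 -> t 2 4 5 = 0 ->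
  t 0 4 5 = - (c * a) -> t 1 3 5 = 4 * (c * a) ->
  (forall i, (i < 5)%N -> t i 5 5 = 2 * c * l i) ->
  t 5 5 5 = 6 * c * (b + 4 * a ^+ 3) ->
  forall i j k, (i < 6)%N -> (j < 6)%N -> (k < 6)%N ->
  t i j k = normal_tensor c a b l i j k.
Proof.
move=> c e02 e03 e14 e24 e04 e13 e55 e555 i j k; apply: sym_tensor_sorted => {i j k} // i j k.
- by rewrite /normal_tensor /hankel_tensor sort3C12.
- by rewrite /normal_tensor /hankel_tensor sort3C23.
case: (tR 5) => R0 R1 R2 R3 [R4 R5 R6 R7 R8].
have e11 : t 1 1 5 = 0 by rewrite -R2 e02 mulr0 add0r.
have e12 : t 1 2 5 = 0 by rewrite -R3 e03 add0r.
have e22 : t 2 2 5 = - 6 * (c * a).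
  by apply/eqP; rewrite -subr_eq0 -R4 e04 e13; apply/eqP; ring.
have e23 : t 2 3 5 = 0 by rewrite -R5 e14 add0r.
have e33 : t 3 3 5 = 0 by rewrite -R6 e24 mulr0 add0r.
move=> /andP[ij jk]; rewrite ltnS leq_eqVlt => /orP[/eqP k5|k5]; last first.
  have j5 := leq_ltn_trans jk k5; have i5 := leq_ltn_trans ij j5.
  rewrite quartic_tensorE //; move: i i5 j j5 k k5 {ij jk}.
  by do 3!move=> [_|[_|[_|[_|[_|//]]]]].
rewrite {k}k5 in jk *; move: i j ij jk => [|[|[|[|[|[|i]]]]]] [|[|[|[|[|[|j]]]]]] // _ _;
  by rewrite /normal_tensor /= ?e55 // ?(R0, R1, R7, R8, e11, e12, e22, e23, e33).
Qed.
End HankelTensor.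

(** * The normal form as the cubic of its tensor *)

Section Expansions.
Variables (A : comNzRingType) (f : nat -> nat -> A).
Variables (V : nmodType) (u : nat -> V).

Lemma det3 :
  \det (\matrix_(i < 3, j < 3) f i j) =
    f 0 0 * (f 1 1 * f 2 2 - f 1 2 * f 2 1) - f 0 1 * (f 1 0 * f 2 2 - f 1 2 * f 2 0)
    + f 0 2 * (f 1 0 * f 2 1 - f 1 1 * f 2 0).
Proof.
rewrite (expand_det_row _ ord0) !big_ord_recl big_ord0 /cofactor.
rewrite !(expand_det_row _ ord0) !big_ord_recl !big_ord0 /cofactor !det_mx11 !mxE /=.
by rewrite /bump /=; ring.
Qed.

Lemma sum_ord6 : \sum_(i < 6) u i = u 0 + u 1 + u 2 + u 3 + u 4 + u 5.
Proof. by rewrite !big_ord_recr big_ord0 /= add0r. Qed.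

Lemma sum_ord5 : \sum_(i < 5) u i = u 0 + u 1 + u 2 + u 3 + u 4.
Proof. by rewrite !big_ord_recr big_ord0 /= add0r. Qed.

End Expansions.

Section NormalFormExpansion.
Variables (K : closedFieldType) (a b : K) (l : {mpoly K[5]}).
Let x (k : nat) : {mpoly K[6]} := 'X_(inord k).

Lemma normal_formE :
  normal_form a b l =
    x 0 * (x 2 - a *: x 5) * x 4 - x 0 * x 3 ^+ 2 - x 1 ^+ 2 * x 4
    + 2 * (x 1 * x 3 * (x 2 + (2 * a) *: x 5))
    - (x 2 + (2 * a) *: x 5) ^+ 2 * (x 2 - a *: x 5)
    + x 5 ^+ 2 * mwiden l + b *: x 5 ^+ 3.
Proof.
rewrite /normal_form /normal_form_mx; congr (_ + _ + _).
rewrite (det3 (fun i j => nth 0 (nth [::] [:: [:: x 0; x 1; x 2 + (2 * a) *: x 5];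
  [:: x 1; x 2 - a *: x 5; x 3]; [:: x 2 + (2 * a) *: x 5; x 3; x 4]] i) j)) /=.
ring.
Qed.

End NormalFormExpansion.

Section NormalTensor.
Variables (K : numFieldType) (A : comNzRingType) (h : {rmorphism K -> A}).
Variables (c a b : K) (l : nat -> K) (x : nat -> A).
Let q (i j : nat) := \sum_(k < 6) x k * h (normal_tensor c a b l i j k).

(** The variables are abstract elements of a commutative ring, so that [ring] can decide the
    identity; polynomials come afterwards. *)
Lemma normal_tensor_cubic :
  \sum_(i < 6) x i * \sum_(j < 6) x j * \sum_(k < 6)
    x k * h (normal_tensor c a b l i j k) =
  h (6 * c) * (x 0 * (x 2 - h a * x 5) * x 4 - x 0 * x 3 ^+ 2 - x 1 ^+ 2 * x 4
    + 2 * (x 1 * x 3 * (x 2 + h (2 * a) * x 5))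
    - (x 2 + h (2 * a) * x 5) ^+ 2 * (x 2 - h a * x 5)
    + x 5 ^+ 2 * (\sum_(i < 5) h (l i) * x i) + h b * x 5 ^+ 3).
Proof.
rewrite (sum_ord5 (fun i => h (l i) * x i)).
transitivity (\sum_(i < 6) x i * \sum_(j < 6) x j * q i j) => //.
rewrite (sum_ord6 (fun i => x i * \sum_(j < 6) x j * q i j)).
rewrite !(sum_ord6 (fun j => x j * q _ j)).
(* Each [q i j] is a linear form in the [x k]. Simplifying these 21 forms first keeps the last
   [ring] call small. *)
have qE i j : q i j = _ := sum_ord6 (fun k => x k * h (normal_tensor c a b l i j k)).
have q12 i j : q i j = q j i.
  by apply: eq_bigr => k _; rewrite /normal_tensor /hankel_tensor sort3C12.
have [q00 q01 q02 q03] : [/\ q 0 0 = 0, q 0 1 = 0, q 0 2 = h c * x 4 &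
    q 0 3 = h (- 2 * c) * x 3].
  by split; rewrite qE /normal_tensor /hankel_tensor /=; ring.
have [q04 q05 q11 q12'] : [/\ q 0 4 = h c * x 2 - h (c * a) * x 5,
    q 0 5 = h (2 * c * l 0) * x 5 - h (c * a) * x 4,
    q 1 1 = h (- 2 * c) * x 4 & q 1 2 = h (2 * c) * x 3].
  by split; rewrite qE /normal_tensor /hankel_tensor /=; ring.
have [q13 q14 q15 q22] : [/\ q 1 3 = h (2 * c) * x 2 + h (4 * (c * a)) * x 5,
    q 1 4 = h (- 2 * c) * x 1,
    q 1 5 = h (4 * (c * a)) * x 3 + h (2 * c * l 1) * x 5 &
    q 2 2 = h (- 6 * c) * x 2 + h (- 6 * (c * a)) * x 5].
  by split; rewrite qE /normal_tensor /hankel_tensor /=; ring.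
have [q23 q24 q25 q33] : [/\ q 2 3 = h (2 * c) * x 1, q 2 4 = h c * x 0,
    q 2 5 = h (- 6 * (c * a)) * x 2 + h (2 * c * l 2) * x 5 &
    q 3 3 = h (- 2 * c) * x 0].
  by split; rewrite qE /normal_tensor /hankel_tensor /=; ring.
have [q34 q35 q44] : [/\ q 3 4 = 0,
    q 3 5 = h (4 * (c * a)) * x 1 + h (2 * c * l 3) * x 5 & q 4 4 = 0].
  by split; rewrite qE /normal_tensor /hankel_tensor /=; ring.
have [q45 q55] : q 4 5 = h (2 * c * l 4) * x 5 - h (c * a) * x 0 /\
    q 5 5 = h (2 * c * l 0) * x 0 + h (2 * c * l 1) * x 1
      + h (2 * c * l 2) * x 2 + h (2 * c * l 3) * x 3 + h (2 * c * l 4) * x 4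
      + h (6 * c * (b + 4 * a ^+ 3)) * x 5.
  by split; rewrite qE /normal_tensor /hankel_tensor /=; ring.
rewrite (q12 1 0) (q12 2 0) (q12 3 0) (q12 4 0) (q12 5 0) (q12 2 1) (q12 3 1).
rewrite (q12 4 1) (q12 5 1) (q12 3 2) (q12 4 2) (q12 5 2) (q12 4 3) (q12 5 3) (q12 5 4).
rewrite q00 q01 q02 q03 q04 q05 q11 q12' q13 q14 q15 q22 q23 q24 q25 q33 q34 q35.
rewrite q44 q45 q55; ring.
Qed.

End NormalTensor.

Lemma normal_tensor_poly (K : numClosedFieldType) (c a b : K) (l : nat -> K) :
  \sum_(i < 6) 'X_i * \sum_(j < 6) 'X_j * \sum_(k < 6)
    'X_k * (normal_tensor c a b l i j k)%:MP =
  (6 * c) *: normal_form a b (\sum_(i < 5) l i *: 'X_i) :> {mpoly K[6]}.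
Proof.
pose x k : {mpoly K[6]} := 'X_(inord k).
have xE (i : 'I_6) : 'X_i = x i by rewrite /x inord_val.
have -> : \sum_(i < 6) 'X_i * \sum_(j < 6) 'X_j * \sum_(k < 6)
    'X_k * (normal_tensor c a b l i j k)%:MP =
    \sum_(i < 6) x i * \sum_(j < 6) x j * \sum_(k < 6)
    x k * (normal_tensor c a b l i j k)%:MP.
  by do 3![apply: eq_bigr => ? _; rewrite xE; congr (_ * _)].
rewrite normal_tensor_cubic normal_formE -/(x _) raddf_sum /=.
have -> : \sum_(i < 5) mwiden (l i *: 'X_i) = \sum_(i < 5) (l i)%:MP * x i.
  apply: eq_bigr => i _; rewrite mwidenZ mul_mpolyC mwidenX mnmwiden1.
  congr (_ *: 'X_[U_(_)]); apply: val_inj.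
  by rewrite /= inordK // (ltn_trans (ltn_ord i)).
by rewrite -!mul_mpolyC.
Qed.

(** * Trilinear calculus and the choice of coordinates *)

Section TrilinearTheory.
Variables (K : numFieldType) (n : nat).
Variable T : 'rV[K]_n -> 'rV[K]_n -> 'rV[K]_n -> K.
Hypothesis symT : sym_trilinear T.

Lemma triC12 x y z : T x y z = T y x z. Proof. by case: symT. Qed.

Lemma triC23 x y z : T x y z = T x z y. Proof. by case: symT. Qed.

Lemma triC13 x y z : T x y z = T z y x. Proof. by rewrite triC12 triC23 triC12. Qed.

Lemma tri0r x y : T x y 0 = 0.
Proof.
by case: symT => Tl _ _; have := Tl x y (-1) 0 0; rewrite scaler0 addr0 mulN1r addNr.
Qed.

Lemma triDr x y z w : T x y (z + w) = T x y z + T x y w.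
Proof. by case: symT => Tl _ _; have := Tl x y 1 z w; rewrite scale1r mul1r. Qed.

Lemma triZr x y a z : T x y (a *: z) = a * T x y z.
Proof. by case: symT => Tl _ _; have := Tl x y a z 0; rewrite tri0r !addr0. Qed.

Lemma tri_sumr x y (I : finType) (a : I -> K) (z : I -> 'rV[K]_n) :
  T x y (\sum_i a i *: z i) = \sum_i a i * T x y (z i).
Proof.
by rewrite (big_morph _ (triDr x y) (tri0r x y)); apply: eq_bigr => i _; rewrite triZr.
Qed.

Lemma tri_sumlm (I : finType) (a b : I -> K) (x : I -> 'rV[K]_n) w :
  T (\sum_i a i *: x i) (\sum_i b i *: x i) w =
  \sum_i \sum_j a i * b j * T (x i) (x j) w.
Proof.
rewrite triC13 tri_sumr; apply: eq_bigr => i _.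
rewrite triC13 triC23 tri_sumr mulr_sumr; apply: eq_bigr => j _.
by rewrite mulrA triC23.
Qed.

End TrilinearTheory.

Lemma poly_eval0 (K : numFieldType) (p : {poly K}) : (forall s, p.[s] = 0) -> p = 0.
Proof.
move=> p0; apply/eqP/negPn/negP => pn0.
pose rs := [seq i%:R | i <- iota 0 (size p)] : seq K.
have urs : uniq rs by rewrite map_inj_uniq ?iota_uniq // => i j /eqP; rewrite eqr_nat => /eqP.
have : all (root p) rs by apply/allP => s _; rewrite rootE p0.
by move=> /(max_poly_roots pn0) /(_ urs); rewrite size_map size_iota ltnn.
Qed.

Section CubicNormalForm.
Variable K : numClosedFieldType.
Variable T : 'rV[K]_6 -> 'rV[K]_6 -> 'rV[K]_6 -> K.
Hypothesis symT : sym_trilinear T.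
Variable e : nat -> 'rV[K]_6.
Hypothesis singT : forall s w,
  T (\sum_(i < 5) s ^+ i *: e i) (\sum_(i < 5) s ^+ i *: e i) w = 0.

Lemma singular_quartic_relations w :
  let q i j := T (e i) (e j) w in
  [/\ q 0%N 0%N = 0, q 0%N 1%N = 0, 2 * q 0%N 2%N + q 1%N 1%N = 0,
      q 0%N 3%N + q 1%N 2%N = 0 & [/\ 2 * q 0%N 4%N + 2 * q 1%N 3%N + q 2%N 2%N = 0,
      q 1%N 4%N + q 2%N 3%N = 0, 2 * q 2%N 4%N + q 3%N 3%N = 0, q 3%N 4%N = 0 & q 4%N 4%N = 0]].
Proof.
move=> q.
(* The nine coefficients of the degree 8 polynomial in [s] given by [T (g s) (g s) w], where [g s]
   is the point of parameter [s]. *)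
pose c := [:: q 0%N 0%N; 2 * q 0%N 1%N; 2 * q 0%N 2%N + q 1%N 1%N; 2 * (q 0%N 3%N + q 1%N 2%N);
  2 * q 0%N 4%N + 2 * q 1%N 3%N + q 2%N 2%N;
  2 * (q 1%N 4%N + q 2%N 3%N); 2 * q 2%N 4%N + q 3%N 3%N; 2 * q 3%N 4%N;
  q 4%N 4%N].
have qC i j : q i j = q j i by rewrite /q (triC12 symT).
have c0 : Poly c = 0.
  apply: poly_eval0 => s; rewrite horner_Poly /=.
  have := singT s w; rewrite (tri_sumlm symT).
  rewrite (sum_ord5 (fun i => \sum_(j < 5) s ^+ i * s ^+ j * q i j)).
  rewrite !(sum_ord5 (fun j => s ^+ _ * s ^+ j * q _ j)) => H; rewrite -[RHS]H.
  rewrite (qC 1%N 0%N) (qC 2%N 0%N) (qC 3%N 0%N) (qC 4%N 0%N) (qC 2%N 1%N).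
  rewrite (qC 3%N 1%N) (qC 4%N 1%N).
  by rewrite (qC 3%N 2%N) (qC 4%N 2%N) (qC 4%N 3%N); ring.
have ck k : nth 0 c k = 0 by rewrite -coef_Poly c0 coef0.
have n2 x : 2 * x = 0 -> x = 0 :> K.
  by move/eqP; rewrite mulf_eq0 pnatr_eq0 => /eqP.
split; [exact: (ck 0) | exact: n2 (ck 1) | exact: (ck 2) | exact: n2 (ck 3) | split].
- exact: (ck 4).
- exact: n2 (ck 5).
- exact: (ck 6).
- exact: n2 (ck 7).
- exact: (ck 8).
Qed.

Lemma singular_quartic_tensor i j k : (i < 5)%N -> (j < 5)%N -> (k < 5)%N ->
  T (e i) (e j) (e k) = hankel_tensor (T (e 0) (e 2) (e 4)) i j k.
Proof.
apply: (quartic_tensorE (t := fun i j k => T (e i) (e j) (e k))).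
- by move=> *; exact: triC12.
- by move=> *; exact: triC23.
- by move=> w; apply: singular_quartic_relations.
Qed.

Lemma cubic_normal_form (F : {mpoly K[6]}) : polarizes F T ->
  \matrix_(i < 6) e i \in unitmx -> T (e 0) (e 2) (e 4) != 0 ->
  exists (g : 'M[K]_6) (c a b : K) (l : {mpoly K[5]}),
    [/\ g \in unitmx, c != 0, l \is 1.-homog &
        change_coords g F = c *: normal_form a b l].
Proof.
move=> [_ _ _ FT] Eu; set c := T (e 0) (e 2) (e 4) => c0.
(* Replacing [e 5] by [f] adds the sum of the [m k * hankel_tensor c i j k] to the entry [q i j]. So
   [m 4], [m 3], [m 1], [m 0] cancel the entries 02, 03, 14, 24. The entries 04 and 13 both involve
   [m 2] alone; requiring them to be [- (c * a)] and [4 * (c * a)] determines [m 2] and [a]. *)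
pose q i j : K := T (e i) (e j) (e 5).
pose a := (q 1%N 3%N - 2 * q 0%N 4%N) / (6 * c).
pose m : nat -> K := nth 0 [:: - q 2%N 4%N / c; q 1%N 4%N / (2 * c); - a - q 0%N 4%N / c;
  q 0%N 3%N / (2 * c);  - q 0%N 2%N / c].
pose f := e 5 + \sum_(k < 5) m k *: e k.
pose e' (k : nat) := if k == 5%N then f else e k.
pose t (i j k : nat) : K := T (e' i) (e' j) (e' k).
(* The determinant itself contributes [4 * a ^+ 3] to the coefficient of the cube of the last
   variable, hence the correction in [b]. *)
pose l (i : nat) : K := t i 5%N 5%N / (2 * c); pose b := t 5%N 5%N 5%N / (6 * c) - 4 * a ^+ 3.
have tq i j : (i < 5)%N -> (j < 5)%N ->
    t i j 5%N = q i j + \sum_(k < 5) m k * hankel_tensor c i j k.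
  have e'E k : (k < 5)%N -> e' k = e k by move=> k5; rewrite /e' ltn_eqF.
  move=> i5 j5; rewrite /t (e'E i) // (e'E j) // /e' /= /f (triDr symT) (tri_sumr symT).
  by congr (_ + _); apply: eq_bigr => k _; rewrite singular_quartic_tensor.
have tE i j k : (i < 6)%N -> (j < 6)%N -> (k < 6)%N -> t i j k = normal_tensor c a b l i j k.
  have ht i j := sum_ord5 (fun k => m k * hankel_tensor c i j k).
  have tc : t 0%N 2%N 4%N = c by [].
  apply: (normal_tensorE (t := t)).
  - by move=> *; exact: triC12.
  - by move=> *; exact: triC23.
  - move=> w; rewrite /quartic_relations /t /e' /=; exact: singular_quartic_relations.
  - by rewrite tq // ht /hankel_tensor /m /=; field.
  - by rewrite tq // ht /hankel_tensor /m /=; field.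
  - by rewrite tq // ht /hankel_tensor /m /=; field.
  - by rewrite tq // ht /hankel_tensor /m /=; field.
  - by rewrite tq // ht /hankel_tensor /m tc /a /=; field.
  - by rewrite tq // ht /hankel_tensor /m tc /a /=; field.
  - by move=> i' _; rewrite tc /l; field.
  - by rewrite tc /b; field.
(* The base change from [e] to [e'] is [1 + U] with [U] of square zero, hence invertible with
   inverse [1 - U]. *)
pose U : 'M[K]_6 := \matrix_(i, j) (if (i == 5%N :> nat) && (j < 5)%N then m j else 0).
have UU : U *m U = 0.
  apply/matrixP => i j; rewrite !mxE big1 // => k _; rewrite !mxE.
  by case: ltngtP => [|/=|->]; rewrite ?(andbF, andbT, mulr0, mul0r).
have Eu' : \matrix_(i < 6) e' i \in unitmx.
  have -> : \matrix_(i < 6) e' i = (1%:M + U) *m \matrix_(i < 6) e i.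
    apply/row_matrixP => i; rewrite mulmxDl mul1mx linearD /= !rowK.
    rewrite row_mul (mulmx_sum_row (row i U)).
    rewrite big_ord_recr /= !mxE /= andbF scale0r addr0 /e' /f.
    case: eqVneq => [i5|/negPf i5] /=; last first.
      by rewrite big1 ?addr0 // => k _; rewrite !mxE /= i5 scale0r.
    rewrite i5; congr (_ + _); apply: eq_bigr => k _.
    by rewrite !mxE !rowK /= i5 /= ltn_ord.
  rewrite unitmx_mul Eu andbT; have [] // := @mulmx1_unit _ _ (1%:M + U) (1%:M - U).
  by rewrite mulmxDl mul1mx mulmxBr mulmx1 UU subr0 subrK.
exists (\matrix_(i, j) e' j 0 i), (6 * c), a, b, (\sum_(i < 5) l i *: 'X_i); split.
- rewrite -unitmx_tr; suff -> : (\matrix_(i, j) e' j 0 i)^T = \matrix_(i < 6) e' i by [].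
  by apply/matrixP => i j; rewrite !mxE.
- by rewrite mulf_neq0 // pnatr_eq0.
- by apply: rpred_sum => i _; apply: rpredZ; rewrite dhomogX /= mdeg1.
rewrite FT -normal_tensor_poly.
apply: eq_bigr => i _; congr (_ * _); apply: eq_bigr => j _; congr (_ * _).
apply: eq_bigr => k _; congr (_ * _%:MP); rewrite -tE // /t.
by congr T; apply/rowP => s; rewrite !mxE.
Qed.
End CubicNormalForm.

(** * Forms on irreducible sets and chains *)

Section Forms.
Variables (K : numClosedFieldType) (n : nat).
Implicit Types (X I : set 'rV[K]_n.+1) (f g : 'rV[K]_n.+1 -> K).

(** Forms are kept as functions on vectors, so that coordinates such as [x *m a] can be multiplied
    and compared by their values. *)
Definition is_form (d : nat) f :=
  exists2 F : {mpoly K[n.+1]}, F \is d.-homog & forall x, f x = F.@[x 0].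

Lemma is_form_lin (a : 'cV[K]_n.+1) : is_form 1 (fun x => (x *m a) 0 0).
Proof.
exists (\sum_i a i 0 *: 'X_i).
  by apply: rpred_sum => i _; apply: rpredZ; rewrite dhomogX /= mdeg1.
move=> x; rewrite mxE raddf_sum; apply: eq_bigr => i _ /=.
by rewrite mevalZ mevalXU mulrC.
Qed.

Lemma is_formM d1 d2 f g : is_form d1 f -> is_form d2 g ->
  is_form (d1 + d2) (fun x => f x * g x).
Proof.
move=> [F hF fE] [G hG gE]; exists (F * G); first exact: dhomogM.
by move=> x; rewrite fE gE mevalM.
Qed.

Lemma is_formB d f g : is_form d f -> is_form d g -> is_form d (fun x => f x - g x).
Proof.
move=> [F hF fE] [G hG gE]; exists (F - G); first exact: rpredB.
by move=> x; rewrite fE gE mevalB.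
Qed.

Lemma is_formZ d a f : is_form d f -> is_form d (fun x => a * f x).
Proof.
move=> [F hF fE]; exists (a *: F); first exact: rpredZ.
by move=> x; rewrite fE mevalZ.
Qed.

Lemma is_form_prod (I : Type) (r : seq I) (d : I -> nat) (f : I -> 'rV[K]_n.+1 -> K) :
  (forall i, is_form (d i) (f i)) ->
  is_form (\sum_(i <- r) d i) (fun x => \prod_(i <- r) f i x).
Proof.
move=> hf; elim: r => [|i r IHr].
  by exists 1 => [|x]; rewrite big_nil ?dhomog1 ?meval1.
have [F hF fE] := is_formM (hf i) IHr; exists F; first by rewrite big_cons.
by move=> x; rewrite big_cons -fE.
Qed.

Lemma proj_closed_neq0 X x : proj_closed X -> X x -> x != 0.
Proof. by move=> [S [_ ->]] []. Qed.

(** [X] is covered by the zero sets of the two forms, hence lies in one of them. *)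
Lemma irreducible_formM X d1 d2 f g : irreducible_closed X ->
  is_form d1 f -> is_form d2 g -> (forall x, X x -> f x * g x = 0) ->
  (forall x, X x -> f x = 0) \/ (forall x, X x -> g x = 0).
Proof.
move=> [Xc _ Xirr] [F hF fE] [G hG gE] fg.
have pc d (H : {mpoly K[n.+1]}) : H \is d.-homog -> proj_closed (proj_zeros [set H]).
  by move=> hH; exists [set H]; split=> // _ ->; exists d.
case: (Xirr _ _ (pc _ _ hF) (pc _ _ hG)) => [x Xx|XF|XG].
- have x0 := proj_closed_neq0 Xc Xx.
  have /eqP := fg x Xx; rewrite mulf_eq0 fE gE => /orP[]/eqP h.
    by left; split=> // _ ->.
  by right; split=> // _ ->.
- by left=> x /XF[_ /(_ F erefl)]; rewrite fE.
- by right=> x /XG[_ /(_ G erefl)]; rewrite gE.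
Qed.

Lemma irreducible_form_prod X (I : eqType) (r : seq I) (d : I -> nat)
    (f : I -> 'rV[K]_n.+1 -> K) : irreducible_closed X ->
  (forall i, is_form (d i) (f i)) ->
  (forall x, X x -> \prod_(i <- r) f i x = 0) ->
  exists2 i, i \in r & forall x, X x -> f i x = 0.
Proof.
move=> Xirr hf; elim: r => [|i r IHr] H.
  case: Xirr => _ [x /H]; rewrite big_nil => /eqP; by rewrite oner_eq0.
have := irreducible_formM Xirr (hf i) (is_form_prod r hf).
case=> [x /H|fi|/IHr[j jr fj]]; first by rewrite big_cons.
  by exists i; rewrite // mem_head.
by exists j; rewrite // inE jr orbT.
Qed.

Lemma form_along_curve d f (P : 'I_n.+1 -> {poly K}) : is_form d f ->
  exists p : {poly K}, forall t, f (\row_i (P i).[t]) = p.[t].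
Proof.
move=> [F _ fE]; exists (\sum_(m <- msupp F) F@_m *: \prod_i P i ^+ m i) => t.
rewrite fE mevalE horner_sum; apply: eq_bigr => m _.
rewrite hornerZ horner_prod; congr (_ * _); apply: eq_bigr => i _.
by rewrite mxE horner_exp.
Qed.

(** A criterion for irreducibility of the closure: any two points lie on a polynomial curve inside
    [I]. As [I] lives in the affine cone, it may contain 0. *)
Definition curve_connected I := forall x y, I x -> I y ->
  exists P : 'I_n.+1 -> {poly K}, [/\ forall t, I (\row_i (P i).[t]),
    exists t, x = \row_i (P i).[t] & exists t, y = \row_i (P i).[t]].

Definition zariski_closure I := proj_zeros [set F : {mpoly K[n.+1]} |
  (exists d : nat, F \is d.-homog) /\ forall x, I x -> x != 0 -> F.@[x 0] = 0].

Lemma sub_zariski_closure I x : I x -> x != 0 -> zariski_closure I x.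
Proof. by move=> Ix x0; split=> // F [_]; apply. Qed.

Lemma zariski_closure_min I X : proj_closed X ->
  (forall x, I x -> x != 0 -> X x) -> zariski_closure I `<=` X.
Proof.
move=> [S [Sh XE]] IX x [x0 hx]; rewrite XE; split=> // F SF.
apply: hx; split; first exact: Sh.
by move=> y Iy y0; have := IX y Iy y0; rewrite XE => -[_]; apply.
Qed.

Lemma proj_closed_closure I : proj_closed (zariski_closure I).
Proof. by eexists; split; last reflexivity; move=> F []. Qed.

(** If neither closed set contained [I], forms [F] and [G] from the two sets would be nonzero at
    points [y] and [z] of [I]. Along a curve joining [y] to [z] their product is a nonzero
    polynomial, yet it vanishes at every parameter. *)
Lemma irreducible_closure I x : curve_connected I -> I x -> x != 0 ->
  irreducible_closed (zariski_closure I).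
Proof.
move=> Icc Ix x0; split; first exact: proj_closed_closure.
  by exists x; apply: sub_zariski_closure.
move=> _ _ [A [Ah ->]] [B [Bh ->]] IAB.
have aux (S : set {mpoly K[n.+1]}) : (forall F, S F -> exists d : nat, F \is d.-homog) ->
    ~ zariski_closure I `<=` proj_zeros S ->
    exists y F, [/\ I y, y != 0, S F & F.@[y 0] != 0].
  move=> Sh; apply: contra_notP => nex z [z0 Iz]; split=> // F SF.
  apply: Iz; split; first exact: Sh.
  move=> y Iy y0; apply/eqP/negPn/negP => Fy; apply: nex.
  by exists y, F.
apply: contrapT => /not_orP[/(aux _ Ah)[y [F [Iy y0 AF Fy]]]].
move=> /(aux _ Bh)[z [G [Iz z0 BG Gz]]].
have [P [IP [ty yE] [tz zE]]] := Icc _ _ Iy Iz.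
have [[dF hF] [dG hG]] := (Ah F AF, Bh G BG).
have [pF pFE] := @form_along_curve dF (fun x => F.@[x 0]) P (ex_intro2 _ _ F hF (fun=> erefl)).
have [pG pGE] := @form_along_curve dG (fun x => G.@[x 0]) P (ex_intro2 _ _ G hG (fun=> erefl)).
(* The curve may pass through the zero vector, which is no projective point. The extra factor [P j]
   vanishes at such parameters and is nonzero as a polynomial. *)
have [j yj] : exists j, y 0 j != 0.
  apply: contrapT => nex; case/eqP: y0; apply/rowP => j; rewrite mxE.
  by apply/eqP/negPn/negP => yj; apply: nex; exists j.
have : pF * pG * P j != 0.
  rewrite !mulf_neq0 //.
  - by apply: contraNneq Fy => p0; rewrite yE pFE p0 horner0.
  - by apply: contraNneq Gz => p0; rewrite zE pGE p0 horner0.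
  - by apply: contraNneq yj => p0; rewrite yE mxE p0 horner0.
move=> /eqP; apply; apply: poly_eval0 => t; rewrite !hornerM.
have [/eqP-> | Pt0] := boolP ((P j).[t] == 0); first by rewrite mulr0.
have w0 : \row_i (P i).[t] != 0.
  by apply: contraNneq Pt0 => /rowP/(_ j); rewrite !mxE => ->.
case: (IAB _ (sub_zariski_closure (IP t) w0)) => -[_].
  by move=> /(_ F AF); rewrite pFE => ->; rewrite !mul0r.
by move=> /(_ G BG); rewrite pGE => ->; rewrite mulr0 mul0r.
Qed.

(** The chain consists of the closures of [I 0], [I 1], [I 2]; the linear form [a k] vanishes on
    [I k] but not on [I k.+1], which makes the inclusions strict. *)
Lemma chain2_of_connected X (I : nat -> set 'rV[K]_n.+1) (a : nat -> 'cV[K]_n.+1) x0 :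
  proj_closed X -> (forall k, curve_connected (I k)) ->
  (forall k, I k `<=` I k.+1) -> (forall x, I 2%N x -> x != 0 -> X x) ->
  I 0%N x0 -> x0 != 0 ->
  (forall k, (k < 2)%N -> (forall x, I k x -> x *m a k = 0) /\
     exists2 x, I k.+1 x & x *m a k != 0) ->
  irreducible_chain X 2.
Proof.
move=> Xc Icc Isub IX Ix0 x00 aP; exists (fun k => zariski_closure (I k)); split.
  move=> i i2; have Ile k : I 0%N `<=` I k.
    by elim: k => // k IHk; apply: subset_trans IHk (Isub k).
  split; first exact: irreducible_closure (Icc i) (Ile i _ Ix0) x00.
  apply: zariski_closure_min => // x Ix; apply: IX.
  case: i i2 Ix => [|[|[|]]] // _ Ix; first exact/Isub/Isub.
  exact: Isub.
move=> i /aP [aI [x Ix ax]]; split.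
  apply: zariski_closure_min; first exact: proj_closed_closure.
  by move=> y Iy; apply: sub_zariski_closure; apply: Isub.
have xn0 : x != 0 by apply: contraNneq ax => ->; rewrite mul0mx.
have [F hF fE] := is_form_lin (a i).
move=> /(_ x (sub_zariski_closure Ix xn0)) [_ /(_ F)] Fx; case/eqP: ax.
rewrite [LHS]mx11_scalar fE Fx ?raddf0 //; split; first by exists 1%N.
by move=> y Iy _; rewrite -fE aI // mxE.
Qed.

(** * Chains on quadric surfaces *)

Section QuadricSurface.
Variables (q0 q1 q2 q3 : 'rV[K]_n.+1) (b01 b02 b03 b12 b13 b23 : K).

(* Stereographic projection of the quadric from its point [q0]. The constant [k]
   replaces the linear form by [1] when the quadric degenerates to the whole space. *)
Definition stereographic (k b c d : K) : 'rV[K]_n.+1 :=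
  - (b12 * b * c + b13 * b * d + b23 * c * d) *: q0
  + (k + b01 * b + b02 * c + b03 * d) *: (b *: q1 + c *: q2 + d *: q3).

(** Two parameter triples are joined by a segment. The factors [m2] and [m3] will be 0 or 1 and
    switch parameters off. *)
Lemma stereographic_connected (k m2 m3 : K) :
  curve_connected [set x | exists b c d, x = stereographic k b (m2 * c) (m3 * d)].
Proof.
move=> _ _ [b [c [d ->]]] [b' [c' [d' ->]]].
pose seg (u v : K) : {poly K} := u%:P + (v - u) *: 'X.
pose B := seg b b'; pose C := m2 *: seg c c'; pose D := m3 *: seg d d'.
pose P i := - (b12 *: (B * C) + b13 *: (B * D) + b23 *: (C * D)) * (q0 0 i)%:P
  + (k%:P + b01 *: B + b02 *: C + b03 *: D)
    * (q1 0 i *: B + q2 0 i *: C + q3 0 i *: D).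
have PE t : \row_i (P i).[t] = stereographic k (b + (b' - b) * t)
    (m2 * (c + (c' - c) * t)) (m3 * (d + (d' - d) * t)).
  apply/rowP => i; rewrite !mxE /P /C /D /B /seg.
  rewrite !(hornerD, hornerN, hornerM, hornerZ, hornerC, hornerX); ring.
exists P; split.
- by move=> t; rewrite PE; do 3!eexists.
- by exists 0; rewrite PE !mulr0 !addr0.
- by exists 1; rewrite PE !mulr1 !subrKC.
Qed.

(** The chain is the point [q1], the closure of the image of the parameter plane [d = 0], and the
    closure of the full image. The last hypothesis covers a quadric with [b01 != 0] and the case
    where the whole space spanned by the [q]s lies in [X]. *)
Lemma quadric_surface_chain X (a2 a3 : 'cV[K]_n.+1) : proj_closed X ->
  q1 != 0 -> q0 *m a2 = 0 -> q1 *m a2 = 0 -> q2 *m a2 = 1%:M ->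
  q0 *m a3 = 0 -> q1 *m a3 = 0 -> q2 *m a3 = 0 -> q3 *m a3 = 1%:M ->
  (forall a b c d, let x := a *: q0 + b *: q1 + c *: q2 + d *: q3 in
     x != 0 -> b01 * a * b + b02 * a * c + b03 * a * d
     + b12 * b * c + b13 * b * d + b23 * c * d = 0 -> X x) ->
  b01 != 0 \/ [/\ b01 = 0, b02 = 0, b03 = 0 & [/\ b12 = 0, b13 = 0 & b23 = 0]] ->
  irreducible_chain X 2.
Proof.
move=> Xc q1n q02 q12 q22 q03 q13 q23 q33 HX Hb.
pose k : K := if b01 == 0 then 1 else 0.
(* At the parameters [(v, 0, 0)], [(w2, 1, 0)] and [(w3, 0, 1)] the linear factor of the
   parametrization equals 1. The first gives a nonzero point, the other two are detected by [a2] and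
   [a3]. *)
have [v v0 kv] : exists2 v, v != 0 & k + b01 * v = 1.
  rewrite /k; case: eqP => [->|/eqP b0].
    by exists 1; rewrite ?oner_neq0 // mul0r addr0.
  by exists b01^-1; rewrite ?invr_eq0 // divff // add0r.
have [w2 kw2] : exists w, k + b01 * w + b02 = 1.
  rewrite /k; case: Hb => [b0|[-> -> _ _]].
    by exists ((1 - b02) / b01); rewrite (negPf b0); field.
  by exists 0; rewrite eqxx mulr0 !addr0.
have [w3 kw3] : exists w, k + b01 * w + b03 = 1.
  rewrite /k; case: Hb => [b0|[-> _ -> _]].
    by exists ((1 - b03) / b01); rewrite (negPf b0); field.
  by exists 0; rewrite eqxx mulr0 !addr0.
(* [I j] frees the first [j] of the parameters [c], [d] and sets the others to 0. *)
pose m i j : K := (i <= j)%:R.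
pose I j := [set x | exists b c d, x = stereographic k b (m 1%N j * c) (m 2%N j * d)].
pose A j := if j == 0%N then a2 else a3.
apply: (@chain2_of_connected X I A (stereographic k v 0 0)) => //.
- by move=> j; apply: stereographic_connected.
- move=> j _ [b [c [d ->]]]; exists b, (m 1%N j * c), (m 2%N j * d).
  by rewrite /m; case: j => [|[|j]]; rewrite /= ?mul1r ?mul0r.
- move=> _ [b [c [d ->]]]; rewrite /m /= !mul1r => x0.
  have xE : stereographic k b c d = - (b12 * b * c + b13 * b * d + b23 * c * d) *: q0
      + ((k + b01 * b + b02 * c + b03 * d) * b) *: q1
      + ((k + b01 * b + b02 * c + b03 * d) * c) *: q2
      + ((k + b01 * b + b02 * c + b03 * d) * d) *: q3.
    by rewrite /stereographic !scalerDr !scalerA !addrA.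
  rewrite xE in x0 *; apply: HX => //; rewrite /k.
  by case: Hb => [/negPf->|[-> -> -> [-> -> ->]]]; ring.
- by exists v, 0, 0; rewrite !mulr0.
- by rewrite /stereographic !mulr0 !addr0 oppr0 scale0r add0r kv scale1r
    !scale0r !addr0 scaler_eq0 negb_or v0.
have SE (B : 'cV[K]_n.+1) b c d : stereographic k b c d *m B =
    - (b12 * b * c + b13 * b * d + b23 * c * d) *: (q0 *m B)
    + (k + b01 * b + b02 * c + b03 * d) *: (b *: (q1 *m B) + c *: (q2 *m B) + d *: (q3 *m B)).
  by rewrite /stereographic mulmxDl -!scalemxAl !mulmxDl -!scalemxAl.
move=> [|[|j]] //= _; split.
- move=> _ [b [c [d ->]]]; rewrite SE /m /A /= !mul0r q02 q12.
  by rewrite !scale0r !scaler0 !addr0 !scaler0 addr0.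
- exists (stereographic k w2 1 0); first by exists w2, 1, 0; rewrite /m /= mulr1 mul0r.
  rewrite SE /A /= q02 q12 q22 !mulr0 !mulr1 !addr0 kw2 !scaler0 !add0r !scale1r.
  by rewrite scale0r addr0 oner_neq0.
- move=> _ [b [c [d ->]]]; rewrite SE /m /A /= !mul0r q03 q13 q23.
  by rewrite !scale0r !scaler0 !addr0 !scaler0 addr0.
- exists (stereographic k w3 0 1); first by exists w3, 0, 1; rewrite /m /= mulr0 mul1r.
  rewrite SE /A /= q03 q13 q23 q33 !mulr0 !mulr1 !addr0 kw3 !scaler0 !add0r !scale1r.
  by rewrite oner_neq0.
Qed.

End QuadricSurface.

End Forms.

(** * Singular loci *)

Section SingularLocus.
Variables (K : numClosedFieldType) (n : nat) (F : {mpoly K[n.+1]}).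
Variable T : 'rV[K]_n.+1 -> 'rV[K]_n.+1 -> 'rV[K]_n.+1 -> K.
Hypothesis FT : polarizes F T.

(** [3 * T x x w] is the derivative of [F] at [x] in the direction [w], and the value [F x] is the
    case [w = x]. *)
Lemma sing_locusP x : sing_locus F x <-> x != 0 /\ forall w, T x x w = 0.
Proof.
have [symT FE dFE _] := FT.
split=> [[x0 _ dF]|[x0 Tx]].
  split=> // w; rewrite (row_sum_delta w) (tri_sumr symT) big1 // => i _.
  have /eqP := dF i; rewrite dFE mulf_eq0 pnatr_eq0 /= => /eqP->.
  by rewrite mulr0.
by split=> // [|i]; rewrite ?FE ?dFE Tx ?mulr0.
Qed.

Lemma proj_closed_sing : F \is 3.-homog -> proj_closed (sing_locus F).
Proof.
move=> hF; exists [set G | G = F \/ exists i, G = F^`M(i)]; split.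
  by move=> G [->|[i ->]]; [exists 3%N|exists 2%N; apply: dhomog_mderiv].
apply/seteqP; split=> [x [x0 Fx dFx]|x [x0 Fx]].
  by split=> // G [->|[i ->]].
by split=> // [|i]; apply: Fx; [left|right; exists i].
Qed.

End SingularLocus.

Section DualBasis.
Variables (K : fieldType) (n : nat) (p : nat -> 'rV[K]_n.+1).
Let P := \matrix_(i < n.+1) p i.
Hypothesis Pu : P \in unitmx.

Definition dual_col (j : nat) : 'cV[K]_n.+1 := col (inord j) (invmx P).

Definition coordp (j : nat) (x : 'rV[K]_n.+1) : K := (x *m dual_col j) 0 0.

Lemma mulmx_dual_col i j : (i <= n)%N -> (j <= n)%N ->
  p i *m dual_col j = (i == j)%:R%:M.
Proof.
move=> i_n j_n; apply/matrixP => a b; rewrite !ord1 !mxE.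
have /matrixP/(_ (inord i) (inord j)) := mulmxV Pu.
rewrite !mxE -val_eqE /= !inordK // => <-.
by apply: eq_bigr => k _; rewrite !mxE inordK.
Qed.

Lemma coordp_basis i j : (i <= n)%N -> (j <= n)%N -> coordp j (p i) = (i == j)%:R.
Proof. by move=> i_n j_n; rewrite /coordp mulmx_dual_col // mxE. Qed.

Lemma coordpE x : x = \sum_(i < n.+1) coordp i x *: p i.
Proof.
rewrite -{1}[x](mulmxKV Pu) mulmx_sum_row; apply: eq_bigr => i _.
rewrite rowK; congr (_ *: _); rewrite /coordp /dual_col inord_val !mxE.
by apply: eq_bigr => k _; rewrite !mxE.
Qed.

End DualBasis.

Section VanishingRestriction.
Variables (K : numClosedFieldType) (F : {mpoly K[6]}).
Variable T : 'rV[K]_6 -> 'rV[K]_6 -> 'rV[K]_6 -> K.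
Hypothesis FT : polarizes F T.
Hypothesis hF : F \is 3.-homog.
Variable p : nat -> 'rV[K]_6.
Hypothesis Pu : \matrix_(i < 6) p i \in unitmx.
Hypothesis Tsing : forall i w, (i < 5)%N -> T (p i) (p i) w = 0.
Hypothesis T0 : forall i j k, (i < 5)%N -> (j < 5)%N -> (k < 5)%N ->
  T (p i) (p j) (p k) = 0.

(** For [x] in the span of [p 0, ..., p 4], only the [p 5] component of [w] contributes to
    [T x x w], so the singular points there are the zeros of the quadric [b]. Its square terms
    vanish because the [p i] are singular. It is cut with the solid spanned by four of the [p i],
    the first two chosen with [b i0 i1 != 0] unless [b] is zero. *)
Lemma vanishing_restriction_chain : irreducible_chain (sing_locus F) 2.
Proof.
have [symT _ _ _] := FT.
pose b i j := T (p i) (p j) (p 5).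
have bC i j : b i j = b j i by rewrite /b (triC12 symT).
have bii i : (i < 5)%N -> b i i = 0 by move=> i5; rewrite /b Tsing.
have main i0 i1 i2 i3 : uniq [:: i0; i1; i2; i3] ->
    all (fun i => i < 5)%N [:: i0; i1; i2; i3] ->
    b i0 i1 != 0 \/ (forall i j, (i < 5)%N -> (j < 5)%N -> b i j = 0) ->
    irreducible_chain (sing_locus F) 2.
  rewrite /= !inE !negb_or => /and4P[/and3P[n01 n02 n03] /andP[n12 n13] n23 _].
  move=> /and5P[l0 l1 l2 l3 _] Hb.
  have dual i j : (i < 5)%N -> (j < 5)%N -> p i *m dual_col p j = (i == j)%:R%:M.
    by move=> i5 j5; apply: mulmx_dual_col => //; apply: ltnW.
  have pn0 i : (i < 5)%N -> p i != 0.
    move=> i5; apply/eqP => pi0; have := dual i i i5 i5.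
    rewrite pi0 mul0mx eqxx => /matrixP/(_ 0 0); rewrite !mxE => /eqP.
    by rewrite eq_sym oner_eq0.
  apply: (@quadric_surface_chain _ _ (p i0) (p i1) (p i2) (p i3) (b i0 i1) (b i0 i2)
    (b i0 i3) (b i1 i2) (b i1 i3) (b i2 i3) _ (dual_col p i2) (dual_col p i3)).
  - exact: proj_closed_sing hF.
  - exact: pn0.
  1-7: by rewrite dual // ?eqxx ?(negPf n02) ?(negPf n12) ?(negPf n03)
    ?(negPf n13) ?(negPf n23) ?raddf0.
  - move=> a0 a1 a2 a3 x x0 qx; apply/(sing_locusP FT); split=> // w.
    rewrite (coordpE Pu w) (tri_sumr symT) big1 // => k _.
    pose q := nth 0 [:: p i0; p i1; p i2; p i3].
    pose a := nth 0 [:: a0; a1; a2; a3].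
    have -> : x = \sum_(i < 4) a i *: q i.
      by rewrite !big_ord_recr big_ord0 /= add0r.
    rewrite (tri_sumlm symT).
    have [k5|k5] := ltnP k 5.
      rewrite big1 ?mulr0 // => i _; rewrite big1 // => j _.
      suff -> : T (q i) (q j) (p k) = 0 by rewrite mulr0.
      by case: i => [[|[|[|[|]]]] //= _]; case: j => [[|[|[|[|]]]] //= _];
        rewrite T0.
    have -> : val k = 5%N by apply/eqP; rewrite eqn_leq k5 -ltnS ltn_ord.
    rewrite !big_ord_recr !big_ord0 /= -!/(b _ _).
    rewrite !bii // (bC i1 i0) (bC i2 i0) (bC i3 i0) (bC i2 i1) (bC i3 i1) (bC i3 i2).
    rewrite -[RHS](mulr0 (2 * coordp p 5 w)) -[in RHS]qx /a /=; ring.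
  - by case: Hb => [?|b0]; [left|right; split; [| | |split]; apply: b0].
have [[i [j [i5 j5 bij]]]|nb] :=
    pselect (exists i j, [/\ (i < 5)%N, (j < 5)%N & b i j != 0]); last first.
  apply: (main 0 1 2 3)%N => //; right=> i j i5 j5; apply/eqP/negPn/negP => bij.
  by apply: nb; exists i, j.
have ij : i != j by apply: contraNneq bij => ->; rewrite bii.
pose s := [seq k <- iota 0 5 | k \notin [:: i; j]].
apply: (main i j (nth 0 s 0) (nth 0 s 1)); last by left.
  by move: i j i5 j5 ij @s {bij}; do 2!move=> [|[|[|[|[|//]]]]].
by move: i j i5 j5 ij @s {bij}; do 2!move=> [|[|[|[|[|//]]]]].
Qed.

End VanishingRestriction.

(** * The Cremona transformation *)

Section Cremona.
Variables (K : numFieldType) (c : nat -> nat -> nat -> K).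
Hypothesis cC12 : forall i j k, c i j k = c j i k.
Hypothesis cC23 : forall i j k, c i j k = c i k j.
Hypothesis cii : forall i k, (i < 5)%N -> (k < 5)%N -> c i i k = 0.

(* The cubic [sum c_ijk x_i x_j x_k] has no square terms, hence is
   [x_0 x_1 x_2 x_3 x_4] times a quadratic form in the inverses of the [x_i]. *)
Definition cremona_coef (l m : nat) : K :=
  if l == m then 0 else
  let s := [seq k <- iota 0 5 | k \notin [:: l; m]] in
  c (nth 0%N s 0) (nth 0%N s 1) (nth 0%N s 2).

Lemma cremona_coefC l m : cremona_coef l m = cremona_coef m l.
Proof.
rewrite /cremona_coef eq_sym; case: ifP => // _.
have -> // : [seq k <- iota 0 5 | k \notin [:: l; m]] =
    [seq k <- iota 0 5 | k \notin [:: m; l]].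
by apply: eq_filter => k; rewrite !inE orbC.
Qed.

Let c_sorted (s : seq nat) : K := c (nth 0%N s 0) (nth 0%N s 1) (nth 0%N s 2).

Lemma tensor_sorted i j k : c i j k = c_sorted (sort leq [:: i; j; k]).
Proof.
pose n := (maxn i (maxn j k)).+1.
apply: (@sym_tensor_sorted K c cC12 cC23 n
  (fun i j k => c_sorted (sort leq [:: i; j; k]))); rewrite ?ltnS ?leq_max ?leqnn ?orbT //.
- by move=> *; rewrite sort3C12.
- by move=> *; rewrite sort3C23.
move=> i' j' k' /andP[ij jk] _; rewrite sorted_sort //=; last by rewrite ij jk.
exact: leq_trans.
Qed.

(** An entry with a repeated index vanishes by hypothesis; one with distinct indices is the
    coefficient at the complementary pair of indices. *)
Lemma cremona_coef_eq0 : (forall l m, (l < 5)%N -> (m < 5)%N -> cremona_coef l m = 0) ->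
  forall i j k, (i < 5)%N -> (j < 5)%N -> (k < 5)%N -> c i j k = 0.
Proof.
move=> D0 i j k; apply: (sym_tensor_sorted cC12 cC23 (f := fun _ _ _ => 0)) => //.
move=> {}i {}j {}k /andP[ij jk] k5.
have j5 := leq_ltn_trans jk k5; have i5 := leq_ltn_trans ij j5.
move: ij jk; rewrite leq_eqVlt => /orP[/eqP<-|ij]; first by rewrite cii.
rewrite leq_eqVlt => /orP[/eqP<-|jk]; first by rewrite cC12 cC23 cii.
pose s := [seq m <- iota 0 5 | m \notin [:: i; j; k]].
have sE : [/\ (nth 0 s 0 < 5)%N, (nth 0 s 1 < 5)%N &
    cremona_coef (nth 0%N s 0) (nth 0%N s 1) = c i j k].
  rewrite /s; move: i j k i5 j5 k5 ij jk {s}.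
  by do 3!move=> [|[|[|[|[|//]]]]] //.
by case: sE => s0 s1 <-; apply: D0.
Qed.

Variable x : nat -> K.
Hypothesis x0 : forall i, (i < 5)%N -> x i != 0.
Hypothesis Hx : forall k, (k < 5)%N -> \sum_(i < 5) \sum_(j < 5) x i * x j * c i j k = 0.

(** Let [f] be the cubic and [e k] a third of its partial derivative, so that [f] is the sum of the
    [x k * e k]. Then [f - 3 * x m * e m] collects the monomials free of [x m], those whose
    complementary pair contains [m]; times [x m], it is [6 * X] times the sum in question. *)
Lemma cremona_singular m : (m < 5)%N ->
  \sum_(l < 5) (x l)^-1 * cremona_coef l m = 0.
Proof.
(* [g] computes to sorted entries with distinct indices, so that [field] sees each independent
   coefficient as one atom. *)
pose g i j k := if uniq [:: i; j; k] then c_sorted (sort leq [:: i; j; k]) else 0.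
pose e k := \sum_(i < 5) \sum_(j < 5) x i * x j * g i j k.
have cg i j k : (i < 5)%N -> (j < 5)%N -> (k < 5)%N -> c i j k = g i j k.
  move=> i5 j5 k5; rewrite /g /= !inE !andbT.
  case: (eqVneq i j) => [<-|_]; first by rewrite cii.
  case: (eqVneq i k) => [<-|_] /=; first by rewrite cC23 cii.
  by case: (eqVneq j k) => [<-|_]; [rewrite cC12 cC23 cii|rewrite tensor_sorted].
have E k : (k < 5)%N -> e k = 0.
  move=> k5; rewrite -[RHS](Hx k5); apply: eq_bigr => i _; apply: eq_bigr => j _.
  by rewrite cg.
pose X := x 0 * x 1 * x 2 * x 3 * x 4.
have Xn0 : 6 * X != 0 by rewrite !mulf_neq0 ?pnatr_eq0 ?x0.
move=> m5; apply: (mulfI Xn0); rewrite mulr0.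
transitivity (x m * (x 0 * e 0%N + x 1 * e 1%N + x 2 * e 2%N + x 3 * e 3%N + x 4 * e 4%N
    - 3 * x m * e m)); last by rewrite !E // !mulr0 !addr0 subr0 mulr0.
have [n0 n1 n2 n3 n4] : [/\ x 0 != 0, x 1 != 0, x 2 != 0, x 3 != 0 & x 4 != 0].
  by split; apply: x0.
have eE k := sum_ord5 (fun i => \sum_(j < 5) x i * x j * g i j k).
have eE' i k := sum_ord5 (fun j => x i * x j * g i j k).
rewrite (sum_ord5 (fun l => (x l)^-1 * cremona_coef l m)) /e !eE !eE' /X.
case: m m5 => [|[|[|[|[|//]]]]] _; rewrite /g /cremona_coef /c_sorted /=;
  by field; rewrite n0 n1 n2 n3 n4.
Qed.
End Cremona.

(** With zero diagonal, the principal minor at [i, j, k] equals [2 * D i j * D j k * D k i], and it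
    vanishes in rank at most 2. *)
Lemma sym_rank2_minor (K : numFieldType) n (D : 'M[K]_n) i j k :
  (forall a b, D a b = D b a) -> (forall a, D a a = 0) -> (\rank D <= 2)%N ->
  D i j * D j k * D k i = 0.
Proof.
move=> Dsym Dii rD; pose s := nth k [:: i; j; k].
pose S : 'M[K]_(3, n) := \matrix_(a < 3, b < n) (b == s a)%:R.
have SDS : S *m D *m S^T = \matrix_(a < 3, b < 3) D (s a) (s b).
  apply/matrixP => a b; rewrite !mxE (bigD1 (s b)) //= big1 => [|l ls].
    rewrite addr0 !mxE eqxx mulr1 (bigD1 (s a)) //= big1 => [|l ls].
      by rewrite addr0 mxE eqxx mul1r.
    by rewrite mxE (negPf ls) mul0r.
  by rewrite !mxE (negPf ls) mulr0.
have rS : (\rank (S *m D *m S^T) < 3)%N.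
  apply: leq_ltn_trans (mxrankM_maxl _ _) _.
  exact: leq_ltn_trans (mxrankM_maxr _ _) _.
have d0 : \det (\matrix_(a < 3, b < 3) D (s a) (s b)) = 0.
  rewrite -SDS; apply/eqP/negPn/negP => dn0.
  have : S *m D *m S^T \in unitmx by rewrite unitmxE unitfE.
  by rewrite -row_free_unit => /eqP rE; rewrite rE in rS.
move: d0; rewrite (det3 (fun a b => D (s a) (s b))) /s /= !Dii.
rewrite (Dsym j i) (Dsym k j) (Dsym i k) => /eqP H.
apply/eqP; have n2 : (2 : K) != 0 by rewrite pnatr_eq0.
rewrite -(mulrI_eq0 _ (mulfI n2)); apply: etrans H; congr (_ == _); ring.
Qed.

(** * Inverse coordinates of the points of the curve *)

Section CremonaCurve.
Variable K : numClosedFieldType.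
Variable T : 'rV[K]_6 -> 'rV[K]_6 -> 'rV[K]_6 -> K.
Hypothesis symT : sym_trilinear T.
Variable p : nat -> 'rV[K]_6.
Hypothesis Pu : \matrix_(i < 6) p i \in unitmx.
Variable C : set 'rV[K]_6.
Hypothesis Cirr : irreducible_closed C.
Hypothesis Cp : forall i, (i < 5)%N -> C (p i).
Hypothesis C5 : forall x, C x -> coordp p 5 x = 0.
Hypothesis Csing : forall x w, C x -> T x x w = 0.
Hypothesis Tn0 : ~ forall i j k, (i < 5)%N -> (j < 5)%N -> (k < 5)%N ->
  T (p i) (p j) (p k) = 0.

Let X := coordp p.

Definition in_torus (x : 'rV[K]_6) := forall i, (i < 5)%N -> X i x != 0.

Lemma coordp_form i : is_form 1 (X i).
Proof. exact: is_form_lin. Qed.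

(** The torus is dense in [C]: no coordinate [X i] vanishes on [C], being 1 at [p i], so by
    irreducibility neither does their product. *)
Lemma vanish_of_torus d f : is_form d f ->
  (forall x, C x -> in_torus x -> f x = 0) -> forall x, C x -> f x = 0.
Proof.
move=> hf f0; have := irreducible_formM Cirr hf
  (is_form_prod (index_enum 'I_5) (fun i : 'I_5 => coordp_form i)).
case=> // [x Cx|/(irreducible_form_prod Cirr (fun i : 'I_5 => coordp_form i))].
  have [xT|] := pselect (in_torus x); first by rewrite f0 // mul0r.
  move=> /existsNP[i /not_implyP[i5 /negP/negPn/eqP Xi]].
  by rewrite (bigD1 (Ordinal i5)) //= Xi mul0r mulr0.
move=> [i _ /(_ _ (Cp (ltn_ord i)))/eqP]; rewrite /X coordp_basis // ?eqxx ?oner_eq0 //.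
  exact: ltnW.
exact: ltnW.
Qed.

(** Clearing denominators gives a linear form vanishing on [C] by density; its values at [p i] and
    [p j] are the two coefficients. *)
Lemma torus_pair_free (i j : nat) (a b : K) : (i < 5)%N -> (j < 5)%N -> i != j ->
  (forall x, C x -> in_torus x -> a * (X i x)^-1 + b * (X j x)^-1 = 0) ->
  a = 0 /\ b = 0.
Proof.
move=> i5 j5 ij H.
have : forall x, C x -> a * X j x - (- b) * X i x = 0.
  apply: (@vanish_of_torus 1).
    by apply: is_formB; apply: is_formZ; apply: coordp_form.
  move=> x Cx xT; have := H x Cx xT; have Xi := xT i i5; have Xj := xT j j5.
  move=> /(congr1 (fun y => X i x * X j x * y)); rewrite mulr0 => <-.
  by field; rewrite Xi Xj.
move=> H'; have := H' _ (Cp j5); have := H' _ (Cp i5).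
rewrite /X !coordp_basis // ?(ltnW i5) ?(ltnW j5) // !eqxx (negPf ij) eq_sym (negPf ij).
by rewrite !mulr0 !mulr1 !opprK add0r subr0.
Qed.

Let c i j k := T (p i) (p j) (p k).
Let D : 'M[K]_5 := \matrix_(l, m) cremona_coef c l m.

Lemma torus_kernel x : C x -> in_torus x -> (\row_(i < 5) (X i x)^-1) *m D = 0.
Proof.
move=> Cx xT; apply/rowP => m; rewrite !mxE.
transitivity (\sum_(l < 5) (X l x)^-1 * cremona_coef c l m).
  by apply: eq_bigr => l _; rewrite !mxE.
apply: (@cremona_singular K c _ _ _ (fun l => X l x)) => //.
- by move=> i j k; rewrite /c (triC12 symT).
- by move=> i j k; rewrite /c (triC23 symT).
- by move=> i k i5 _; rewrite /c Csing //; apply: Cp.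
move=> k k5; have := Csing (p k) Cx.
have {1 2}-> : x = \sum_(i < 5) X i x *: p i.
  by rewrite {1}(coordpE Pu x) big_ord_recr /= C5 // scale0r addr0.
by rewrite (tri_sumlm symT).
Qed.

Lemma torus_support (a : 'I_5 -> K) i0 : a i0 != 0 ->
  (#|[pred k | a k != 0%R]| <= 2)%N ->
  ~ (forall x, C x -> in_torus x -> \sum_i a i * (X i x)^-1 = 0).
Proof.
move=> a0 cA H.
have [k ki0 ak] : exists2 k, k != i0 & forall l, l != i0 -> l != k -> a l = 0.
  have cA' : (#|[predD1 [pred k | a k != 0%R] & i0]| <= 1)%N.
    by move: cA; rewrite (cardD1 i0) inE a0.
  case: (pickP [predD1 [pred k | a k != 0] & i0]) => [k kA|nA].
    exists k; first by move: kA => /andP[].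
    move=> l li lk; apply/eqP/negPn/negP => al.
    have lA : l \in [predD1 [pred k | a k != 0] & i0] by rewrite !inE li al.
    by move: lk; rewrite (card_le1_eqP cA' _ _ kA lA) eqxx.
  (* Here [i0] is the only index in the support, and any other index will do; addition in ['I_5] is
     cyclic. *)
  exists (i0 + 1)%R; first by rewrite -subr_eq0 addrC addKr oner_eq0.
  by move=> l li _; have := nA l; rewrite /= li => /negbT; rewrite negbK => /eqP.
have [] := @torus_pair_free i0 k (a i0) (a k) (ltn_ord _) (ltn_ord _).
- by rewrite eq_sym.
- move=> x Cx xT; rewrite -[RHS](H x Cx xT) (bigD1 i0) //= (bigD1 k) //= big1 ?addr0 //.
  by move=> l /andP[li lk]; rewrite ak // mul0r.
by move=> /eqP; rewrite (negPf a0).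
Qed.

(** Suppose the rank is at most 2 and [D i j != 0]. The 3 by 3 minors make the supports of columns
    [i] and [j] disjoint, so one of them has at most two of the five indices. That column is a
    relation between at most two inverses on [C], which [torus_support] excludes. *)
Lemma cremona_rank : (2 < \rank D)%N.
Proof.
rewrite ltnNge; apply/negP => rD.
have Dsym a b : D a b = D b a by rewrite !mxE cremona_coefC.
have Dii a : D a a = 0 by rewrite mxE /cremona_coef eqxx.
have [[i [j Dij]]|nD] := pselect (exists i j, D i j != 0); last first.
  apply: Tn0; apply: (@cremona_coef_eq0 K c).
  - by move=> i j k; rewrite /c (triC12 symT).
  - by move=> i j k; rewrite /c (triC23 symT).
  - by move=> i k i5 _; rewrite /c Csing //; apply: Cp.
  move=> l m l5 m5; apply/eqP/negPn/negP => Dlm; apply: nD.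
  by exists (Ordinal l5), (Ordinal m5); rewrite mxE.
have Dker k x : C x -> in_torus x -> \sum_l D l k * (X l x)^-1 = 0.
  move=> Cx xT; have /rowP/(_ k) := torus_kernel Cx xT; rewrite mxE [RHS]mxE => H; rewrite -[RHS]H.
  by apply: eq_bigr => l _; rewrite [in RHS]mxE mulrC.
pose A m := [pred k | D k m != 0].
have dis : #|[predI A i & A j]| = 0%N.
  apply: eq_card0 => k; rewrite !inE; apply/negbTE; rewrite negb_and !negbK.
  have /eqP := sym_rank2_minor i j k Dsym Dii rD.
  by rewrite !mulf_eq0 (negPf Dij) /= (Dsym j k) orbC.
have : (#|A i| <= 2)%N || (#|A j| <= 2)%N.
  have := max_card [predU A i & A j]; rewrite card_ord => U5.
  rewrite -[(_ <= _)%N || _]negbK negb_or -!ltnNge; apply/negP => /andP[i3 j3].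
  have := leq_add i3 j3; rewrite -cardUI dis addn0 => /leq_trans/(_ U5).
  by [].
by case/orP => cA; [apply: (torus_support (i0 := j) _ cA)|
  apply: (torus_support (i0 := i) _ cA)] => //; rewrite ?(Dsym j) //; apply: Dker.
Qed.

Lemma torus_pair_ex (i j : nat) (a b : K) : (i < 5)%N -> (j < 5)%N -> i != j -> a != 0 ->
  exists2 x, C x /\ in_torus x & a * (X i x)^-1 + b * (X j x)^-1 != 0.
Proof.
move=> i5 j5 ij a0; apply: contrapT => nex.
have [|a_eq0 _] := @torus_pair_free i j a b i5 j5 ij; last by rewrite a_eq0 eqxx in a0.
move=> x Cx xT; apply/eqP/negPn/negP => ne; apply: nex.
by exists x.
Qed.

(** The kernel of [D] has dimension at most 2 and contains the inverse vectors of all torus points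
    of [C]. Two independent ones, [u] and [v], therefore span the others. *)
Lemma torus_pencil : exists u v : nat -> K,
  [/\ forall i, (i < 5)%N -> u i != 0, forall i, (i < 5)%N -> v i != 0,
      forall i j, (i < 5)%N -> (j < 5)%N -> i != j -> u i * v j - u j * v i != 0 &
      forall x, C x -> in_torus x ->
        exists s t, forall i, (i < 5)%N -> (X i x)^-1 = s * u i + t * v i].
Proof.
have [x1 [Cx1 x1T] _] := @torus_pair_ex 0 1 1 0 isT isT isT (oner_neq0 _).
pose u i := (X i x1)^-1.
have u0 i : (i < 5)%N -> u i != 0 by move=> i5; rewrite invr_eq0 x1T.
(* The point [x2] is chosen so that the first two entries of [u] and [v] already form an invertible
   2 by 2 matrix. *)
have [x2 [Cx2 x2T] uv] := @torus_pair_ex 0 1 (u 1%N) (- u 0%N) isT isT isT (u0 1%N isT).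
pose v i := (X i x2)^-1.
have v0 i : (i < 5)%N -> v i != 0 by move=> i5; rewrite invr_eq0 x2T.
have span x : C x -> in_torus x ->
    exists s t, forall i, (i < 5)%N -> (X i x)^-1 = s * u i + t * v i.
  move=> Cx xT; pose y i := (X i x)^-1.
  pose S : 'M[K]_(3, 5) := \matrix_(k < 3) nth 0 [:: \row_(i < 5) u i; \row_(i < 5) v i;
    \row_(i < 5) y i] k.
  have SD : S *m D = 0.
    apply/row_matrixP => k; rewrite row_mul rowK row0.
    by case: k => [[|[|[|//]]] /= _]; apply: torus_kernel.
  have rS : (\rank S < 3)%N.
    have /mxrankS : (S <= kermx D)%MS by apply/sub_kermxP.
    rewrite mxrank_ker => /leq_ltn_trans; apply.
    have := cremona_rank; have := rank_leq_row D; move: (\rank D) => r.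
    by case: r => [|[|[|[|[|[|r]]]]]].
  have [w [w0 wS]] : exists w : 'rV[K]_3, w != 0 /\ w *m S = 0.
    apply: contrapT => nex; have : row_free S.
      apply: inj_row_free => w wS; apply/eqP/negPn/negP => w0.
      by apply: nex; exists w.
    by move=> /eqP rE; rewrite rE in rS.
  pose a := w 0 0; pose b := w 0 1; pose c' := w 0 2.
  have rel i : (i < 5)%N -> a * u i + b * v i + c' * y i = 0.
    move=> i5; have /rowP/(_ (Ordinal i5)) := wS.
    rewrite mxE [RHS]mxE !big_ord_recr big_ord0 /= !mxE /= add0r => H.
    rewrite -[RHS]H /a /b /c'.
    by congr (_ * _ + _ * _ + _ * _); congr (w 0 _); apply: val_inj.
  (* Otherwise the relation would make [u] and [v] dependent in their first two entries. *)
  have c0 : c' != 0.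
    apply: contraNneq w0 => c0; have r0 := rel 0%N isT; have r1 := rel 1%N isT.
    move: r0 r1; rewrite c0 !mul0r !addr0 => r0 r1.
    have b0 : b = 0.
      apply/eqP; rewrite -(mulIr_eq0 _ (mulIf uv)); apply/eqP.
      transitivity (u 1%N * (a * u 0%N + b * v 0%N) - u 0%N * (a * u 1%N + b * v 1%N)).
        by rewrite /v; ring.
      by rewrite r0 r1 !mulr0 subr0.
    have a0 : a = 0.
      move/eqP: r0; rewrite b0 mul0r addr0 mulf_eq0 (negPf (u0 _ _)) // orbF.
      by move/eqP.
    apply/eqP/rowP => k; rewrite mxE.
    by case: k => [[|[|[|//]]] /= k3];
      [rewrite -a0|rewrite -b0|rewrite -c0]; congr (w 0 _); apply: val_inj.
  exists (- (a / c')), (- (b / c')) => i i5; rewrite -/(y i).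
  apply: (mulfI c0); rewrite -[LHS](addKr (a * u i + b * v i)) rel //.
  by rewrite addr0; field.
exists u, v; split=> // i j i5 j5 ij; apply/negP => /eqP uvij.
(* If this minor of the pencil vanished, all inverses on [C] would satisfy a relation between the
   indices [i] and [j] with coefficients [u j] and [- u i]. *)
have [] := @torus_pair_free i j (u j) (- u i) i5 j5 ij; last first.
  by move/eqP; rewrite (negPf (u0 _ _)).
move=> x Cx xT; have [s [t st]] := span x Cx xT; rewrite !st //.
transitivity (- t * (u i * v j - u j * v i)); first by ring.
by rewrite uvij mulr0.
Qed.

End CremonaCurve.

(** * The rational normal quartic *)

Section QuarticCurve.
Variable K : numClosedFieldType.
Variable p : nat -> 'rV[K]_6.
Hypothesis Pu : \matrix_(i < 6) p i \in unitmx.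
Variable C : set 'rV[K]_6.
Hypothesis Cirr : irreducible_closed C.
Hypothesis Cp : forall i, (i < 5)%N -> C (p i).
Hypothesis C5 : forall x, C x -> coordp p 5 x = 0.
Variables u v : nat -> K.
Hypothesis v0 : forall i, (i < 5)%N -> v i != 0.
Hypothesis uv : forall i j, (i < 5)%N -> (j < 5)%N -> i != j ->
  u i * v j - u j * v i != 0.
Hypothesis Cuv : forall x, C x -> in_torus p x ->
  exists s t, forall i, (i < 5)%N -> (coordp p i x)^-1 = s * u i + t * v i.

Let X := coordp p.

(** The inverse of [u i + t * v i] after multiplication by the product of all five such factors; the
    other pencil parameter is set to 1. *)
Definition pencil_poly (i : nat) : {poly K} :=
  \prod_(j < 5 | j != i :> nat) ((u j)%:P + v j *: 'X).

(** The vector coefficients of the parametrized quartic by powers of the parameter, completed by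
    [p 5] to a basis of the whole space. *)
Definition quartic_basis (k : nat) : 'rV[K]_6 :=
  if (k < 5)%N then \sum_(i < 5) (pencil_poly i)`_k *: p i else p 5.

Definition quartic_point (t : K) : 'rV[K]_6 := \sum_(k < 5) t ^+ k *: quartic_basis k.

Let e := quartic_basis.

Lemma horner_pencil_poly i t :
  (pencil_poly i).[t] = \prod_(j < 5 | j != i :> nat) (u j + t * v j).
Proof.
rewrite horner_prod; apply: eq_bigr => j _.
by rewrite hornerD hornerC hornerZ hornerX mulrC.
Qed.

Lemma size_pencil_poly (i : 'I_5) : (size (pencil_poly i) <= 5)%N.
Proof.
apply: leq_trans (size_prod_leq _ _) _.
have card4 : #|[pred j : 'I_5 | j != i :> nat]| = 4.
  by transitivity #|predC1 i|; [apply: eq_card|rewrite cardC1 card_ord].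
rewrite card4 leq_subLR.
have le2 (j : 'I_5) : (size ((u j)%:P + v j *: 'X)%R <= 2)%N.
  apply: leq_trans (size_polyD _ _) _; rewrite geq_max.
  rewrite (leq_trans (size_polyC_leq1 _)) //.
  by rewrite (leq_trans (size_scale_leq _ _)) // size_polyX.
rewrite ltnS (leq_trans (leq_sum _ (fun j _ => le2 j))) //.
by rewrite sum_nat_const card4.
Qed.

(** As in Lagrange interpolation: at the root [- u j / v j] of the [j]-th factor, every pencil
    polynomial vanishes except the [j]-th. *)
Lemma pencil_matrix_unit : \matrix_(i < 5, k < 5) (pencil_poly i)`_k \in unitmx.
Proof.
rewrite -row_free_unit; apply: inj_row_free => w wM.
have w0 : \sum_i w 0 i *: pencil_poly i = 0.
  apply/polyP => k; rewrite coef0 coef_sum.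
  have [k5|k5] := ltnP k 5.
    have /rowP/(_ (Ordinal k5)) := wM; rewrite mxE [RHS]mxE => H; rewrite -[RHS]H.
    by apply: eq_bigr => i _; rewrite coefZ !mxE.
  rewrite big1 // => i _; rewrite coefZ nth_default ?mulr0 //.
  exact: leq_trans (size_pencil_poly i) k5.
apply/rowP => j; rewrite mxE; pose t := - u j / v j.
have vj : v j != 0 by apply: v0.
have tE k : u k + t * v k = (u k * v j - u j * v k) / v j by rewrite /t; field.
have := congr1 (horner^~ t) w0; rewrite horner_sum horner0 (bigD1 j) //= big1 => [|i ij].
  rewrite addr0 hornerZ horner_pencil_poly => /eqP; rewrite mulf_eq0 => /orP[/eqP//|].
  rewrite prodf_seq_eq0 => /hasP[k _ /andP[kj]]; rewrite tE mulf_eq0 invr_eq0.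
  by rewrite (negPf vj) orbF (negPf (uv _ _ _)).
rewrite hornerZ horner_pencil_poly (bigD1 j) //=; last first.
  by move: ij; rewrite eq_sym.
by rewrite tE subrr mul0r mul0r mulr0.
Qed.

Lemma quartic_basis_unit : \matrix_(k < 6) quartic_basis k \in unitmx.
Proof.
rewrite -row_free_unit; apply: inj_row_free => w.
rewrite mulmx_sum_row big_ord_recr /= rowK /= => wE.
have {wE} : \sum_(i < 5) (\sum_(k < 5) w 0 (widen_ord (leqnSn 5) k) * (pencil_poly i)`_k) *: p i
    + w 0 ord_max *: p 5 = 0.
  rewrite -[RHS]wE; congr (_ + _).
  transitivity (\sum_(k < 5) \sum_(i < 5)
      (w 0 (widen_ord (leqnSn 5) k) * (pencil_poly i)`_k) *: p i).
    by rewrite exchange_big; apply: eq_bigr => i _; rewrite scaler_suml.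
  apply: eq_bigr => k _; rewrite rowK /quartic_basis /= ltn_ord scaler_sumr.
  by apply: eq_bigr => i _; rewrite scalerA.
pose a i := if (i < 5)%N then \sum_(k < 5) w 0 (widen_ord (leqnSn 5) k) * (pencil_poly i)`_k
  else w 0 ord_max.
move=> H; have {H} a0 : (\row_(i < 6) a i) *m (\matrix_(i < 6) p i) = 0.
  rewrite mulmx_sum_row big_ord_recr /= rowK mxE -[RHS]H; congr (_ + _).
  by apply: eq_bigr => i _; rewrite rowK mxE /a /= ltn_ord.
have {a0} a0 : \row_(i < 6) a i = 0.
  by rewrite -[LHS](mulmxK Pu) a0 mul0mx.
have w5 : w 0 ord_max = 0 by have /rowP/(_ ord_max) := a0; rewrite !mxE.
have wk : \row_(k < 5) w 0 (widen_ord (leqnSn 5) k) = 0.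
  have Mu : (\matrix_(i < 5, k < 5) (pencil_poly i)`_k)^T \in unitmx.
    by rewrite unitmx_tr pencil_matrix_unit.
  rewrite -[LHS](mulmxK Mu) [X in X *m _](_ : _ = 0) ?mul0mx //.
  apply/rowP => i; rewrite mxE [RHS]mxE.
  have /rowP/(_ (widen_ord (leqnSn 5) i)) := a0; rewrite !mxE /a /= ltn_ord => H.
  by rewrite -[RHS]H; apply: eq_bigr => k _; rewrite !mxE.
apply/rowP => k; rewrite mxE; case: (unliftP ord_max k) => [k'|] ->; last exact: w5.
have /rowP/(_ k') := wk; rewrite !mxE => <-; congr (w 0 _).
by apply: val_inj; rewrite /= /bump leqNgt ltn_ord.
Qed.

Lemma quartic_pointE t : quartic_point t = \sum_(i < 5) (pencil_poly i).[t] *: p i.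
Proof.
rewrite /quartic_point.
transitivity (\sum_(k < 5) \sum_(i < 5) ((pencil_poly i)`_k * t ^+ k) *: p i).
  apply: eq_bigr => k _; rewrite /quartic_basis ltn_ord scaler_sumr.
  by apply: eq_bigr => i _; rewrite scalerA mulrC.
rewrite exchange_big; apply: eq_bigr => i _.
by rewrite (horner_coef_wide _ (size_pencil_poly i)) scaler_suml.
Qed.

(** The condition on [x] excludes the parameter [s = 0], where all products [v i * X i x] coincide;
    elsewhere the affine parameter is [t / s]. *)
Lemma torus_param x : C x -> in_torus p x -> v 1 * X 1 x - v 0 * X 0 x != 0 ->
  exists c t, c != 0 /\ x = c *: quartic_point t.
Proof.
move=> Cx xT lx; have [s [t st]] := Cuv Cx xT.
have s0 : s != 0.
  apply: contraNneq lx => s0; have [X0 X1] := (xT 0%N isT, xT 1%N isT).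
  have vE i : (i < 5)%N -> t * (v i * X i x) = 1.
    by move=> i5; rewrite mulrA -[t * _]add0r -(mul0r (u i)) -s0 -st // mulVf // xT.
  have t0 : t != 0.
    apply/eqP => t0; have := vE 0%N isT; rewrite t0 mul0r => /esym/eqP.
    by rewrite oner_eq0.
  by apply/eqP; apply: (mulfI t0); rewrite mulrBr !vE // mulr0 subrr.
pose r := t / s; have rE i : (i < 5)%N -> (X i x)^-1 = s * (u i + r * v i).
  by move=> i5; rewrite st // /r; field.
have n0 i : (i < 5)%N -> u i + r * v i != 0.
  move=> i5; have : (X i x)^-1 != 0 by rewrite invr_eq0 xT.
  by rewrite rE // mulf_eq0 negb_or => /andP[].
pose c := (s * \prod_(j < 5) (u j + r * v j))^-1.
exists c, r; split.
  by rewrite invr_eq0 mulf_neq0 //; apply/prodf_neq0 => j _; apply: n0.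
rewrite quartic_pointE scaler_sumr {1}(coordpE Pu x) big_ord_recr /= C5 // scale0r addr0.
apply: eq_bigr => i _; rewrite scalerA; congr (_ *: _).
rewrite -[LHS]invrK -/(X i x) rE // horner_pencil_poly /c (bigD1 i) //=.
set P := \prod_(_ < 5 | _) _; have P0 : P != 0 by apply/prodf_neq0 => j _; apply: n0.
by field; rewrite P0 s0 n0.
Qed.

(** The points left out of the parametrization lie in the coordinate hyperplanes or in that of the
    form [v 1 * X 1 x - v 0 * X 0 x]. The latter does not contain [C], as the form is [- v 0] at
    [p 0]. *)
Lemma quartic_vanish d f : is_form d f ->
  (forall c t, c != 0 -> C (c *: quartic_point t) -> f (c *: quartic_point t) = 0) ->
  forall x, C x -> f x = 0.
Proof.
move=> hf H.
have hl : is_form 1 (fun x => v 1 * X 1 x - v 0 * X 0 x).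
  by apply: is_formB; apply: is_formZ; apply: is_form_lin.
case: (irreducible_formM Cirr hf hl) => //.
  apply: (vanish_of_torus Pu Cirr Cp (is_formM hf hl)) => x Cx xT.
  have [/eqP->|lx] := boolP (v 1 * X 1 x - v 0 * X 0 x == 0); first by rewrite mulr0.
  have [c [t [c0 xE]]] := torus_param Cx xT lx.
  by rewrite {1}xE H ?mul0r // -xE.
move=> /(_ _ (Cp (isT : 0 < 5)%N)); rewrite /X !coordp_basis //= mulr0 mulr1 sub0r.
by move/eqP; rewrite oppr_eq0 (negPf (v0 _)).
Qed.

Let Eu := quartic_basis_unit.

Lemma coordp_quartic_sum (a : nat -> K) k : (k < 6)%N ->
  coordp e k (\sum_(i < 5) a i *: e i) = if (k < 5)%N then a k else 0.
Proof.
move=> k6; rewrite /coordp mulmx_suml summxE.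
transitivity (\sum_(i < 5) a i * (i == k :> nat)%:R).
  apply: eq_bigr => i _; rewrite -scalemxAl mxE mulmx_dual_col //; last exact: ltnW.
  by rewrite mxE mulr1n.
case: ltnP => k5.
  rewrite (bigD1 (Ordinal k5)) //= eqxx mulr1 big1 ?addr0 // => i ik.
  by rewrite -val_eqE in ik; rewrite (negPf ik) mulr0.
by rewrite big1 // => i _; rewrite ltn_eqF ?mulr0 // (leq_trans (ltn_ord i)).
Qed.

Lemma coordp_quartic_point c t k : (k < 6)%N ->
  coordp e k (c *: quartic_point t) = if (k < 5)%N then c * t ^+ k else 0.
Proof.
move=> k6; rewrite -(coordp_quartic_sum (fun k => c * t ^+ k)) //; congr coordp.
by rewrite scaler_sumr; apply: eq_bigr => i _; rewrite scalerA.
Qed.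

Lemma quartic_span x : C x -> x = \sum_(k < 5) coordp e k x *: e k.
Proof.
move=> Cx; rewrite {1}(coordpE Eu x) big_ord_recr /= [X in _ + X](_ : _ = 0) ?addr0 //.
rewrite -/e [coordp e 5 x](_ : _ = 0) ?scale0r //; move: x Cx.
apply: (quartic_vanish (is_form_lin _)) => c t _ _.
by rewrite -/(coordp e 5 _) coordp_quartic_point.
Qed.

Lemma quartic_minors x i j : C x -> (i < 4)%N -> (j < 4)%N ->
  coordp e i x * coordp e j.+1 x = coordp e i.+1 x * coordp e j x.
Proof.
move=> Cx i4 j4; apply/eqP; rewrite -subr_eq0; apply/eqP; move: x Cx.
apply: (@quartic_vanish 2).
  by apply: is_formB; apply: (is_formM (is_form_lin _) (is_form_lin _)).
move=> c t _ _.
have zE k : (k < 5)%N -> coordp e k (c *: quartic_point t) = c * t ^+ k.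
  by move=> k5; rewrite coordp_quartic_point ?k5 // ltnW.
rewrite (zE i (ltnW i4)) (zE j (ltnW j4)) (zE i.+1 i4) (zE j.+1 j4) !exprS; ring.
Qed.

(** The inclusion from left to right follows from the 2 by 2 minors, which make the coordinates of a
    point of [C] a geometric progression or leave only the last one. For the converse, every form
    vanishing on [C] is shown to vanish along the quartic. *)
Lemma quartic_curve : C = [set x | exists s t c : K, [/\ (s, t) != (0, 0), c != 0 &
  x = c *: \sum_(i < 5) (s ^+ (4 - i) * t ^+ i) *: e i]].
Proof.
have [Cc _ _] := Cirr.
have gE s t : s != 0 -> \sum_(i < 5) (s ^+ (4 - i) * t ^+ i) *: e i =
    s ^+ 4 *: quartic_point (t / s).
  move=> s0; rewrite scaler_sumr; apply: eq_bigr => i _; rewrite scalerA; congr (_ *: _).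
  have -> : s ^+ 4 = s ^+ (4 - i) * s ^+ i by rewrite -exprD subnK // -ltnS.
  by rewrite expr_div_n; field; rewrite expf_neq0.
apply/seteqP; split=> [x Cx|_ [s [t [c [st0 c0 ->]]]]].
  have x0 := proj_closed_neq0 Cc Cx; have xE := quartic_span Cx.
  pose z k := coordp e k x.
  have zz i j : (i < 4)%N -> (j < 4)%N -> z i * z j.+1 = z i.+1 * z j.
    exact: quartic_minors.
  have [z0|z0] := eqVneq (z 0%N) 0.
    have z1 : z 1%N = 0.
      by have /eqP := zz 0%N 1%N isT isT; rewrite z0 mul0r eq_sym mulf_eq0 orbb => /eqP.
    have z2 : z 2%N = 0.
      by have /eqP := zz 1%N 2%N isT isT; rewrite z1 mul0r eq_sym mulf_eq0 orbb => /eqP.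
    have z3 : z 3%N = 0.
      by have /eqP := zz 2%N 3%N isT isT; rewrite z2 mul0r eq_sym mulf_eq0 orbb => /eqP.
    have {}xE : x = z 4%N *: e 4.
      by rewrite xE (sum_ord5 (fun k => z k *: e k)) z0 z1 z2 z3 !scale0r !add0r.
    exists 0, 1, (z 4%N); split; first by rewrite xpair_eqE oner_eq0 andbF.
      by apply: contraNneq x0 => z4; rewrite xE z4 scale0r.
    rewrite {1}xE; congr (_ *: _).
    rewrite (sum_ord5 (fun i => (0 ^+ (4 - i) * 1 ^+ i) *: e i)) /=.
    by rewrite !expr0n /= !mul0r !scale0r !add0r !mul1r expr1n scale1r.
  exists 1, (z 1%N / z 0%N), (z 0%N); split=> //.
    by rewrite xpair_eqE oner_eq0.
  have zE k : (k < 5)%N -> z k = z 0%N * (z 1%N / z 0%N) ^+ k.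
    elim: k => [|k IHk] k5; first by rewrite expr0 mulr1.
    have := zz 0%N k isT k5; rewrite IHk 1?ltnW // => /(canRL (mulKf z0))->.
    by rewrite exprS; field.
  rewrite {1}xE scaler_sumr; apply: eq_bigr => k _.
  by rewrite scalerA -/(z k) zE // expr1n mul1r.
have yE : coordp e 0 (c *: \sum_(i < 5) (s ^+ (4 - i) * t ^+ i) *: e i) = c * s ^+ 4
    /\ coordp e 4 (c *: \sum_(i < 5) (s ^+ (4 - i) * t ^+ i) *: e i) = c * t ^+ 4.
  have H k : (k < 5)%N -> coordp e k (c *: \sum_(i < 5) (s ^+ (4 - i) * t ^+ i) *: e i)
      = c * (s ^+ (4 - k) * t ^+ k).
    move=> k5; have := coordp_quartic_sum (fun k => c * (s ^+ (4 - k) * t ^+ k)) (ltnW k5).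
    rewrite k5 => <-; congr coordp; rewrite scaler_sumr.
    by apply: eq_bigr => i _; rewrite scalerA.
  by rewrite !H //= expr0 mulr1 mul1r.
set y := c *: _ in yE *.
have y0 : y != 0.
  apply: contraNneq st0 => y0; case: yE; rewrite y0 /coordp !mul0mx !mxE.
  move=> /esym/eqP; rewrite mulf_eq0 (negPf c0) expf_eq0 /= => /eqP->.
  by move=> /esym/eqP; rewrite mulf_eq0 (negPf c0) expf_eq0 /= => /eqP->.
have [S [Sh CE]] := Cc; rewrite CE; split=> // G SG.
have [d hG] := Sh G SG.
have GC x : C x -> G.@[x 0] = 0 by rewrite CE => -[_]; apply.
have GZ a (x : 'rV[K]_6) : G.@[(a *: x) 0] = a ^+ d * G.@[x 0].
  rewrite !mevalE mulr_sumr big_seq [RHS]big_seq; apply: eq_bigr => m mG.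
  rewrite mulrCA; congr (_ * _); under eq_bigr => i _ do rewrite mxE exprMn.
  rewrite big_split /= -expr_sum -mdegE; congr (_ ^+ _ * _).
  exact: (dhomog_mf hG mG).
have Gform : is_form d (fun x => G.@[x 0]) by exists G.
(* If the restriction [q] of [G] to the quartic were nonzero, [C] would be covered by the
   hyperplanes attached to the finitely many roots of [q], and so would lie in one of them. *)
have G1 r : G.@[(quartic_point r) 0] = 0.
  pose P j : {poly K} := \sum_(k < 5) (e k) 0 j *: 'X^k.
  have PE r' : \row_j (P j).[r'] = quartic_point r'.
    apply/rowP => j; rewrite mxE horner_sum summxE; apply: eq_bigr => k _.
    by rewrite hornerZ hornerXn mxE mulrC.
  have [q qE] := form_along_curve P Gform.
  have {}qE r' : G.@[(quartic_point r') 0] = q.[r'] by rewrite -PE qE.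
  rewrite qE; have [->|q0] := eqVneq q 0; first by rewrite horner0.
  have [rs qrs] := closed_field_poly_normal q.
  have hl r' : is_form 1 (fun x => coordp e 1 x - r' * coordp e 0 x).
    by apply: is_formB; [|apply: is_formZ]; apply: is_form_lin.
  have [r' _ Hr'] : exists2 r', r' \in rs & forall x, C x -> coordp e 1 x - r' * coordp e 0 x = 0.
    apply: (irreducible_form_prod Cirr hl).
    apply: (quartic_vanish (is_form_prod rs hl)) => c' t' c'0 /GC.
    rewrite GZ qE => /eqP; rewrite mulf_eq0 expf_eq0 (negPf c'0) andbF /= => qt.
    have : t' \in rs.
      move: qt; rewrite -rootE qrs rootZ ?lead_coef_eq0 // root_prod_XsubC; exact.
    move=> t'rs; apply/eqP; rewrite prodf_seq_eq0; apply/hasP; exists t' => //=.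
    by rewrite !coordp_quartic_point //= expr1 expr0 mulr1 mulrC subrr.
  (* The linear form vanishes on all [p i] with [i < 5], hence at their combination [e 1], where its
     value is 1. *)
  have : coordp e 1 (e 1) - r' * coordp e 0 (e 1) = 0.
    rewrite /e {2 4}/quartic_basis /= -/e /coordp !mulmx_suml !summxE mulr_sumr -sumrB.
    rewrite big1 // => i _; set b := _`_1.
    have zZ k : (b *: p i *m dual_col e k) 0 0 = b * coordp e k (p i).
      by rewrite -scalemxAl mxE.
    by rewrite !zZ mulrCA -mulrBr Hr' ?mulr0 //; apply: Cp.
  rewrite !coordp_basis //= mulr0 subr0 => /eqP; by rewrite oner_eq0.
rewrite GZ; suff -> : G.@[(\sum_(i < 5) (s ^+ (4 - i) * t ^+ i) *: e i) 0] = 0.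
  by rewrite mulr0.
(* The point with [s = 0] is reached by varying [s] with [t] fixed: [G] vanishes for [s != 0], and
   the factor ['X] takes care of [s = 0]. *)
pose P j : {poly K} := \sum_(k < 5) (t ^+ k * (e k) 0 j) *: 'X^(4 - k).
have PE r : \row_j (P j).[r] = \sum_(i < 5) (r ^+ (4 - i) * t ^+ i) *: e i.
  apply/rowP => j; rewrite mxE horner_sum summxE; apply: eq_bigr => k _.
  by rewrite hornerZ hornerXn mxE; ring.
have [q qE] := form_along_curve P Gform.
have q0 : q * 'X = 0.
  apply: poly_eval0 => r; rewrite hornerM hornerX -qE PE.
  have [->|r0] := eqVneq r 0; first by rewrite mulr0.
  by rewrite gE // GZ G1 mulr0 mul0r.
move/eqP: q0; rewrite mulf_eq0 polyX_eq0 orbF => /eqP q0.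
by rewrite -PE qE q0 horner0.
Qed.

End QuarticCurve.

(** * From a spanning curve to its parametrization and the equation of the cubic *)

Lemma free_seq_in_span (K : fieldType) (V : vectType K) (C : set V) (L : {vspace V}) k :
  (forall M : {vspace V}, (forall x, C x -> x \in M) -> (L <= M)%VS) ->
  (k <= \dim L)%N ->
  exists s : seq V, [/\ size s = k, free s & forall x, x \in s -> C x].
Proof.
move=> Lmin; elim: k => [|k IHk] kL; first by exists [::]; rewrite nil_free.
have [s [sk sf sC]] := IHk (ltnW kL).
have [x [Cx xs]] : exists x, C x /\ x \notin <<s>>%VS.
  apply: contrapT => nex; have /dimvS : (L <= <<s>>)%VS.
    by apply: Lmin => x Cx; apply/negPn/negP => xs; apply: nex; exists x.
  by rewrite leqNgt (leq_ltn_trans (dim_span s)) // sk.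
exists (x :: s); rewrite /= sk free_cons xs sf; split=> // y.
by rewrite inE => /orP[/eqP->//|/sC].
Qed.

Section SingularCubic.
Variables (K : numClosedFieldType) (F : {mpoly K[6]}).
Variables (C : set 'rV[K]_6) (L : {vspace 'rV[K]_6}).

Theorem cubic_singular_along_curve : F \is 3.-homog -> has_dim (sing_locus F) 1 ->
  irreducible_closed C -> C `<=` sing_locus F -> is_linear_span C L -> \dim L = 5%N ->
  rational_normal_curve 4 L C /\
  exists (g : 'M[K]_6) (c a b : K) (l : {mpoly K[5]}),
    [/\ g \in unitmx, c != 0, l \is 1.-homog &
        change_coords g F = c *: normal_form a b l].
Proof.
move=> hF [_ dimF] Cirr CF [CL Lmin] dL.
have [T FT] := polarization hF; have [symT _ _ _] := FT.
have Csing x w : C x -> T x x w = 0.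
  by move=> /CF/(sing_locusP FT)[_]; apply.
have [s [s5 sf sC]] : exists s : seq 'rV[K]_6, [/\ size s = 5%N, free s &
    forall x, x \in s -> C x] by apply: free_seq_in_span Lmin _; rewrite dL.
have sL : (<<s>> = L)%VS.
  apply/eqP; rewrite eqEdim; apply/andP; split.
    by apply/span_subvP => x /sC /CL.
  by rewrite dL (eqP sf) s5.
have [w wL] : exists w, w \notin L.
  apply: contrapT => nex; have /dimvS : (fullv <= L)%VS.
    by apply/subvP => x _; apply/negPn/negP => xL; apply: nex; exists x.
  by rewrite dL dimvf /dim /= mul1n.
(* Index 5 falls past the end of [s], so the default value [w] is [p 5]. *)
pose p i := nth w s i.
have Cp i : (i < 5)%N -> C (p i) by move=> i5; apply/sC/mem_nth; rewrite s5.
have p5 : p 5%N = w by rewrite /p nth_default // s5.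
have pE (a : 'I_5 -> K) : \sum_i a i *: p i = \sum_i a i *: (tcast s5 (in_tuple s))`_i.
  apply: eq_bigr => i _; congr (_ *: _); rewrite /p.
  by rewrite val_tcast; apply: set_nth_default; rewrite s5.
have Pu : \matrix_(i < 6) p i \in unitmx.
  rewrite -row_free_unit; apply: inj_row_free => a.
  rewrite mulmx_sum_row big_ord_recr /= rowK /= p5 => aE.
  have {}aE : \sum_(i < 5) a 0 (widen_ord (leqnSn 5) i) *: p i + a 0 ord_max *: w = 0.
    by rewrite -[RHS]aE; congr (_ + _); apply: eq_bigr => i _; rewrite rowK.
  have a5 : a 0 ord_max = 0.
    apply: contraNeq wL => a5.
    have -> : w = - (a 0 ord_max)^-1 *: \sum_(i < 5) a 0 (widen_ord (leqnSn 5) i) *: p i.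
      move/eqP: aE; rewrite addr_eq0 => /eqP->.
      by rewrite scalerN scaleNr opprK scalerA mulVf // scale1r.
    by apply: memvZ; apply: memv_suml => i _; apply: memvZ; apply/CL/Cp.
  have ai (i : 'I_5) : a 0 (widen_ord (leqnSn 5) i) = 0.
    have /freeP H : free (tcast s5 (in_tuple s)) by rewrite val_tcast.
    move: aE; rewrite a5 scale0r addr0 pE => /(H (fun i => a 0 (widen_ord (leqnSn 5) i))).
    exact.
  apply/rowP => k; rewrite mxE; case: (unliftP ord_max k) => [k'|] ->; last exact: a5.
  by rewrite -(ai k'); congr (a 0 _); apply: val_inj; rewrite /= /bump leqNgt ltn_ord.
have C5 x : C x -> coordp p 5 x = 0.
  move=> /CL; rewrite -sL -[s](val_tcast s5 (in_tuple s)) => /coord_span ->.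
  rewrite -pE /coordp mulmx_suml summxE big1 // => i _.
  rewrite -scalemxAl mxE mulmx_dual_col //; last exact: ltnW.
  by rewrite ltn_eqF // mxE mul0rn mulr0.
have Tn0 : ~ forall i j k, (i < 5)%N -> (j < 5)%N -> (k < 5)%N -> T (p i) (p j) (p k) = 0.
  move=> T0; apply: dimF; apply: (vanishing_restriction_chain FT hF Pu) => // i x i5.
  exact/Csing/Cp.
have [u [v [u0 v0 uv Cuv]]] := torus_pencil symT Pu Cirr Cp C5 Csing Tn0.
pose e := quartic_basis p u v.
have Eu : \matrix_(k < 6) e k \in unitmx by apply: quartic_basis_unit.
have CE := quartic_curve Pu Cirr Cp C5 v0 uv Cuv.
have singT r x : T (\sum_(i < 5) r ^+ i *: e i) (\sum_(i < 5) r ^+ i *: e i) x = 0.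
  apply: Csing; rewrite CE; exists 1, r, 1; split; rewrite ?oner_neq0 //.
    by rewrite xpair_eqE oner_eq0.
  by rewrite scale1r; apply: eq_bigr => i _; rewrite expr1n mul1r.
have eL k : (k < 5)%N -> e k \in L.
  move=> k5; rewrite /e /quartic_basis k5; apply: memv_suml => i _; apply: memvZ.
  exact/CL/Cp.
split.
  have nE (i : 'I_5) : [tuple e i | i < 5]`_i = e i by rewrite -tnth_nth tnth_mktuple.
  exists [tuple e i | i < 5]; split.
    rewrite basisEfree size_tuple dL leqnn andbT; apply/andP; split.
      apply/freeP => a aE i; pose b k := a (inord k).
      have <- : coordp e i (\sum_(k < 5) b k *: e k) = a i.
        rewrite (coordp_quartic_sum Pu v0 uv) ?ltn_ord ?(ltn_trans (ltn_ord i)) //.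
        by rewrite /b inord_val.
      transitivity (coordp e i 0); last by rewrite /coordp mul0mx mxE.
      congr coordp; rewrite -[RHS]aE; apply: eq_bigr => k _.
      by rewrite /b inord_val nE.
    by apply/span_subvP => x /mapP[i _ ->]; apply: eL.
  rewrite CE; apply/seteqP; split=> x [r [t [c [rt c0 ->]]]]; exists r, t, c;
    by split=> //; congr (_ *: _); apply: eq_bigr => i _; rewrite nE.
apply: (cubic_normal_form symT singT FT Eu).
(* If this entry vanished, so would the whole Hankel tensor, hence [T] on all of [L], since the
   [p i] are combinations of the [e k]. *)
apply/eqP => e024; apply: Tn0 => i j k i5 j5 k5.
have Te l m n : (l < 5)%N -> (m < 5)%N -> (n < 5)%N -> T (e l) (e m) (e n) = 0.
  move=> l5 m5 n5; rewrite (singular_quartic_tensor symT singT) // e024.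
  move: l l5 m m5 n n5; rewrite /hankel_tensor.
  by do 3!move=> [_|[_|[_|[_|[_|//]]]]]; rewrite /= ?mulr0.
have pes l : (l < 5)%N -> p l = \sum_(k < 5) coordp e k (p l) *: e k.
  by move=> l5; apply: (quartic_span Pu Cirr Cp C5 v0 uv Cuv); apply: Cp.
rewrite (pes i) // (pes j) // (pes k) //.
rewrite (tri_sumlm symT) big1 // => l _; rewrite big1 // => m _.
rewrite (tri_sumr symT) big1 ?mulr0 // => n _.
by rewrite Te ?mulr0.
Qed.

End SingularCubic.

Theorem proposition6p6 (R : realType) (F : {mpoly R[i][6]})
    (C : set 'rV[R[i]]_6) (L : {vspace 'rV[R[i]]_6}) :
  F != 0 -> F \is 3.-homog ->
  has_dim (sing_locus F) 1 ->
  irreducible_curve C -> C `<=` sing_locus F ->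
  is_linear_span C L -> \dim L = 5%N ->
  rational_normal_curve 4 L C /\
  exists (g : 'M[R[i]]_6) (c a b : R[i]) (l : {mpoly R[i][5]}),
    [/\ g \in unitmx, c != 0, l \is 1.-homog &
        change_coords g F = c *: normal_form a b l].
Proof.
by move=> _ hF dimF [Cirr _]; apply: cubic_singular_along_curve.
Qed.
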